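(* Let $K$ be a field, $X=\{x_1,x_2,\ldots\}$ a finite or countable set, $P=K[X\times\mathbb{N}^*]$, $\sigma:P\to P$ the algebra endomorphism $x_i(j)\mapsto x_i(j+1)$, $S=P[s;\sigma]$ endowed with a monomial ordering $\prec$, and let $R\subset S$ be the subalgebra generated by the elements $x_i(1)s$ (isomorphic to $K\langle X\rangle$). The algorithm FreeGBasis2 described in the context is correct: given as input a homogeneous basis $H$ of a graded two-sided ideal $I\subset R$, whenever it terminates, its output $G$ is a homogeneous Gröbner basis of $I$.
   Context: Setting. $\mathbb{N}^*=\{1,2,\ldots\}$; $P$ is the commutative polynomial ring in the variables $x_i(j)=(x_i,j)$; $S=P[s;\sigma]$ is the free left $P$-module with basis $\Sigma=\{s^i\}_{i\ge0}$ and multiplication determined by $sf=\sigma(f)s$ ($f\in P$). $S$ is graded by $S_i=Ps^i$ (write $\deg_s(f)=i$ for $f\in S_i$), and $R$ by $R_i=R\cap S_i$. $\mathrm{Mon}(S)=\{ms^i\mid m\text{ a monomial of }P,i\ge0\}$. A monomial ordering on $S$ is a total well-ordering of $\mathrm{Mon}(S)$ such that $v\prec w$ implies $pvq\prec pwq$ for all $v,w,p,q\in\mathrm{Mon}(S)$. For nonzero $f\in S$: $\mathrm{lm}(f)$ is the $\prec$-largest monomial of $f$, $\mathrm{lc}(f)$ its coefficient, $\mathrm{lt}(f)=\mathrm{lc}(f)\mathrm{lm}(f)$. A Gröbner basis of a two-sided ideal $I\subset R$ is a subset $G\subset I$ such that $\mathrm{lm}(G)$ and $\mathrm{lm}(I)$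 (leading monomials of nonzero elements) generate the same two-sided ideal of $R$. ''Basis'' means generating set. Multidegree: for $m=x_{i_1}(j_1)\cdots x_{i_d}(j_d)$, $\partial(m)=(\mu_k)_{k\in\mathbb{N}^*}$ with $\mu_k=\#\{\alpha\mid j_\alpha=k\}$; $1^d$ is the multidegree with $\mu_k=1$ for $k\le d$ and $0$ otherwise. One has $R_d=P_{1^d}s^d$, where $P_\mu$ is the span of the monomials of multidegree $\mu$. S-polynomials: if $\mathrm{lm}(f)=ms^i$, $\mathrm{lm}(g)=ns^i$ ($m,n$ monomials of $P$), $l=\mathrm{lcm}(m,n)$, then $\mathrm{spoly}(f,g)=\frac{l}{\mathrm{lc}(f)m}f-\frac{l}{\mathrm{lc}(g)n}g$. For the pairs occurring in the algorithm this is a multi-homogeneous element of multidegree $(\partial(l),i)$, and the condition ''$\mathrm{spoly}\in R$'' means that this multidegree is of the form $(1^d,d)$ for some $d\ge0$. Reduce$(f,G)$: set $h:=f$; while $h\ne0$ and there is a nonzero $g\in G$ with $\mathrm{lm}(h)=a\,\mathrm{lm}(g)$ for a monomial $a$ of $P$ (so both have the same $s$-degree), choose such a $g$ and replace $h$ by $h-\frac{\mathrm{lc}(h)}{\mathrm{lc}(g)}a g$; return $h$. $\Sigma G\Sigma=\{s^igs^j\mid g\in G,i,j\ge0\}$. FreeGBasis2. Input: $H$, a homogeneous basis (of nonzero elements) of $I$. Put $G:=H$, $B:=\{(f,g)\mid f,g\in G\}$. While $B\ne\emptyset$: choose $(f,g)\in B$ and remove it from $B$; (1) for all $i,j\ge0$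 with $i+j=\deg_s(f)-\deg_s(g)$ and $\mathrm{spoly}(f,s^igs^j)\in R$, compute $h:=$ Reduce$(\mathrm{spoly}(f,s^igs^j),\Sigma G\Sigma)$, and if $h\neq0$ put $B:=B\cup\{(h,h),(h,k),(k,h)\mid k\in G\}$ and $G:=G\cup\{h\}$; (2) for all $i,j\ge0$ with $j-i=\deg_s(f)-\deg_s(g)$ and $\mathrm{spoly}(fs^i,s^jg)\in R$, compute $h:=$ Reduce$(\mathrm{spoly}(fs^i,s^jg),\Sigma G\Sigma)$, and if $h\ne0$ update $B$ and $G$ in the same way. Return $G$. *)

(* Defs.v *)
From HB Require Import structures.
From mathcomp Require Import all_boot all_order all_algebra.
From mathcomp Require Import finmap classical_sets.
From mathcomp Require Import monalg.

Set Implicit Arguments.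
Unset Strict Implicit.
Unset Printing Implicit Defensive.

Import GRing.Theory.

Local Open Scope ring_scope.

Local Notation "1" := mone : monom_scope.
Local Notation "x * y" := (mmul x y) : monom_scope.

(* A[s; sigma], the free left A-module with basis s^i and the product
   determined by s a = sigma(a) s.  An element sum_i a_i s^i is stored as the
   polynomial with coefficients a_i; the wrapper keeps the commuting-variable
   product of {poly A} out of the way. *)
Record skewpoly (A : nzRingType) (sigma : {rmorphism A -> A}) : Type :=
  SkewPoly { skewval : {poly A} }.

Section SkewPoly.
Context (A : nzRingType) (sigma : {rmorphism A -> A}).
Local Notation T := (skewpoly sigma).
Local Notation Sk := (@SkewPoly A sigma).
Implicit Types (p q r : {poly A}) (a b : A) (f g : T).

HB.instance Definition _ := [isNew for @skewval A sigma].
HB.instance Definition _ := [Choice of T by <:].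

Fact skew_key : unit. Proof. by []. Qed.

Definition skewadd : T -> T -> T :=
  locked_with skew_key (fun f g => Sk (skewval f + skewval g)).
Definition skewopp : T -> T := locked_with skew_key (fun f => Sk (- skewval f)).
Definition skewscale : A -> T -> T :=
  locked_with skew_key (fun a f => Sk (a *: skewval f)).
Definition skewzero : T := locked_with skew_key (Sk 0).

Lemma skewaddE f g : skewval (skewadd f g) = skewval f + skewval g.
Proof. by rewrite /skewadd unlock. Qed.
Lemma skewoppE f : skewval (skewopp f) = - skewval f.
Proof. by rewrite /skewopp unlock. Qed.
Lemma skewscaleE a f : skewval (skewscale a f) = a *: skewval f.
Proof. by rewrite /skewscale unlock. Qed.
Lemma skewzeroE : skewval skewzero = 0.
Proof. by rewrite /skewzero unlock. Qed.
Let skE := (skewaddE, skewoppE, skewscaleE, skewzeroE).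

Fact skewaddA : associative skewadd.
Proof. by move=> f g h; apply: val_inj; rewrite /= !skE addrA. Qed.
Fact skewaddC : commutative skewadd.
Proof. by move=> f g; apply: val_inj; rewrite /= !skE addrC. Qed.
Fact skewadd0 : left_id skewzero skewadd.
Proof. by move=> f; apply: val_inj; rewrite /= !skE add0r. Qed.
Fact skewaddN : left_inverse skewzero skewopp skewadd.
Proof. by move=> f; apply: val_inj; rewrite /= !skE addNr. Qed.

HB.instance Definition _ :=
  GRing.isZmodule.Build T skewaddA skewaddC skewadd0 skewaddN.

Fact skewscaleA a b f : skewscale a (skewscale b f) = skewscale (a * b) f.
Proof. by apply: val_inj; rewrite /= !skE scalerA. Qed.
Fact skewscale1 : left_id 1 skewscale.
Proof. by move=> f; apply: val_inj; rewrite /= !skE scale1r. Qed.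
Fact skewscaleDr : right_distributive skewscale +%R.
Proof. by move=> a f g; apply: val_inj; rewrite /= !skE scalerDr. Qed.
Fact skewscaleDl f : {morph skewscale^~ f : a b / a + b}.
Proof. by move=> a b; apply: val_inj; rewrite /= !skE scalerDl. Qed.

HB.instance Definition _ := GRing.Zmodule_isLmodule.Build A T
  skewscaleA skewscale1 skewscaleDr skewscaleDl.

Definition scoef (i : nat) f : A := (skewval f)`_i.

Definition skewvar : T := locked_with skew_key (Sk 'X).
Lemma skewvarE : skewval skewvar = 'X.
Proof. by rewrite /skewvar unlock. Qed.

Definition skewmul_poly (p q : {poly A}) : {poly A} :=
  \poly_(k < (size p + size q).-1)
    \sum_(i < k.+1) p`_i * iter i sigma q`_(k - i).

Lemma iter_sigma0 i : iter i sigma 0 = 0.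
Proof. by elim: i => //= i ->; rewrite rmorph0. Qed.
Lemma iter_sigma1 i : iter i sigma 1 = 1.
Proof. by elim: i => //= i ->; rewrite rmorph1. Qed.
Lemma iter_sigmaD i : {morph iter i sigma : a b / a + b}.
Proof. by move=> a b; elim: i => //= i ->; rewrite rmorphD. Qed.
Lemma iter_sigmaM i : {morph iter i sigma : a b / a * b}.
Proof. by move=> a b; elim: i => //= i ->; rewrite rmorphM. Qed.
Lemma iter_sigma_sum i (n : nat) (P : pred 'I_n) (F : 'I_n -> A) :
  iter i sigma (\sum_(k < n | P k) F k) = \sum_(k < n | P k) iter i sigma (F k).
Proof.
exact: (big_morph (iter i sigma) (iter_sigmaD i) (iter_sigma0 i)).
Qed.

Lemma coef_skewmul p q k :
  (skewmul_poly p q)`_k = \sum_(i < k.+1) p`_i * iter i sigma q`_(k - i).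
Proof.
rewrite coef_poly -subn1 ltn_subRL add1n.
case: leqP => // le_pq_k1; rewrite big1 // => i _.
have [lt_i|le_i] := ltnP i (size p); last by rewrite nth_default ?mul0r.
rewrite [q`__]nth_default ?iter_sigma0 ?mulr0 //.
have lik : (i <= k)%N by rewrite -ltnS.
rewrite -(leq_add2l i) subnKC // -ltnS.
by apply: leq_trans le_pq_k1; rewrite -addSn leq_add2r.
Qed.

Fact skewmul_A : associative skewmul_poly.
Proof.
move=> p q r; apply/polyP=> k; rewrite !coef_skewmul.
pose F i j : A :=
  p`_i * iter i sigma q`_j * iter (i + j) sigma r`_(k - (i + j)).
transitivity (\sum_(i < k.+1) \sum_(j < k.+1 | (j <= k - i)%N) F i j).
  apply: eq_bigr => i _; rewrite coef_skewmul iter_sigma_sum big_distrr /=.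
  rewrite (big_ord_narrow_leq (leq_subr _ _)) /=; apply: eq_bigr => j _.
  by rewrite /F iter_sigmaM mulrA -iterD subnDA.
transitivity (\sum_(m < k.+1) \sum_(i < k.+1 | (i <= m)%N) F i (m - i)%N); last first.
  apply: eq_bigr => m _; rewrite coef_skewmul big_distrl /=.
  have lemk : (m <= k)%N by rewrite -ltnS.
  rewrite (big_ord_narrow_leq lemk) /=; apply: eq_bigr => i _.
  by rewrite /F subnKC // -ltnS.
rewrite [RHS](exchange_big_dep predT) //=; apply: eq_bigr => i _.
have leik : (i <= k)%N by rewrite -ltnS.
rewrite (big_ord_narrow_leq (leq_subr _ _)) /=.
have -> : \sum_(m < k.+1 | (i <= m)%N) F i (m - i)%N =
          \sum_(i <= m < k.+1) F i (m - i)%N.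
  rewrite big_mkcond -(big_mkord xpredT (fun m => if (i <= m)%N then F i (m - i)%N else 0)).
  rewrite (big_cat_nat (leq0n i) (leqW leik)) /= big_nat big1 ?add0r; last first.
    by move=> j /andP[_]; rewrite ltnNge => /negbTE ->.
  by rewrite big_nat [RHS]big_nat; apply: eq_bigr => j /andP[-> _].
rewrite -[in RHS](add0n (nat_of_ord i)) big_addn subSn // big_mkord.
by apply: eq_bigr => j _; rewrite addnK.
Qed.

Fact skewmul_1p : left_id 1 skewmul_poly.
Proof.
move=> p; apply/polyP=> k; rewrite coef_skewmul big_ord_recl /= coefC eqxx mul1r.
by rewrite subn0 big1 ?addr0 // => i _; rewrite coefC /= mul0r.
Qed.

Fact skewmul_p1 : right_id 1 skewmul_poly.
Proof.
move=> p; apply/polyP=> k; rewrite coef_skewmul big_ord_recr /= subnn coefC eqxx.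
rewrite iter_sigma1 mulr1 big1 ?add0r // => i _.
by rewrite coefC subn_eq0 leqNgt ltn_ord /= iter_sigma0 mulr0.
Qed.

Fact skewmul_Dl : left_distributive skewmul_poly +%R.
Proof.
move=> p q r; apply/polyP=> k; rewrite coefD !coef_skewmul -big_split /=.
by apply: eq_bigr => i _; rewrite coefD mulrDl.
Qed.

Fact skewmul_Dr : right_distributive skewmul_poly +%R.
Proof.
move=> p q r; apply/polyP=> k; rewrite coefD !coef_skewmul -big_split /=.
by apply: eq_bigr => i _; rewrite coefD iter_sigmaD mulrDr.
Qed.

Definition skewmul : T -> T -> T :=
  locked_with skew_key (fun f g => Sk (skewmul_poly (skewval f) (skewval g))).
Definition skewone : T := locked_with skew_key (Sk 1).
Lemma skewmulE f g : skewval (skewmul f g) = skewmul_poly (skewval f) (skewval g).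
Proof. by rewrite /skewmul unlock. Qed.
Lemma skewoneE : skewval skewone = 1.
Proof. by rewrite /skewone unlock. Qed.

Fact skewmulA : associative skewmul.
Proof. by move=> f g h; apply: val_inj; rewrite /= !skewmulE skewmul_A. Qed.
Fact skewmul1 : left_id skewone skewmul.
Proof. by move=> f; apply: val_inj; rewrite /= skewmulE skewoneE skewmul_1p. Qed.
Fact skewmulr1 : right_id skewone skewmul.
Proof. by move=> f; apply: val_inj; rewrite /= skewmulE skewoneE skewmul_p1. Qed.
Fact skewmulDl : left_distributive skewmul +%R.
Proof.
by move=> f g h; apply: val_inj; rewrite /= !(skewaddE, skewmulE) skewmul_Dl.
Qed.
Fact skewmulDr : right_distributive skewmul +%R.
Proof.
by move=> f g h; apply: val_inj; rewrite /= !(skewaddE, skewmulE) skewmul_Dr.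
Qed.
Fact skewone_neq0 : skewone != 0.
Proof.
apply/eqP => /(congr1 (@skewval A sigma)); rewrite skewoneE skewzeroE.
by move/eqP; rewrite oner_eq0.
Qed.

HB.instance Definition _ := GRing.Zmodule_isNzRing.Build T
  skewmulA skewmul1 skewmulr1 skewmulDl skewmulDr skewone_neq0.

Lemma skewpolyP f g : (forall k, scoef k f = scoef k g) -> f = g.
Proof. by move=> h; apply/val_inj/polyP. Qed.

Lemma scoef0 k : scoef k (0 : T) = 0.
Proof. by rewrite /scoef skewzeroE coef0. Qed.

Lemma scoef1 k : scoef k (1 : T) = (k == 0)%:R.
Proof. by rewrite /scoef skewoneE coef1. Qed.

Lemma scoefD f g k : scoef k (f + g) = scoef k f + scoef k g.
Proof. by rewrite /scoef skewaddE coefD. Qed.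

Lemma scoefN f k : scoef k (- f) = - scoef k f.
Proof. by rewrite /scoef skewoppE coefN. Qed.

Lemma scoefZ a f k : scoef k (a *: f) = a * scoef k f.
Proof. by rewrite /scoef skewscaleE coefZ. Qed.

Lemma scoef_skewvar k : scoef k skewvar = (k == 1)%:R.
Proof. by rewrite /scoef skewvarE coefX. Qed.

Lemma scoefM f g k :
  scoef k (f * g) = \sum_(i < k.+1) scoef i f * iter i sigma (scoef (k - i) g).
Proof. by rewrite /scoef skewmulE coef_skewmul. Qed.

Lemma scoef_skewvarM f k :
  scoef k (skewvar * f) = if k is k'.+1 then sigma (scoef k' f) else 0.
Proof.
rewrite scoefM; case: k => [|k]; first by rewrite big_ord1 scoef_skewvar mul0r.
rewrite big_ord_recl scoef_skewvar mul0r add0r.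
rewrite big_ord_recl scoef_skewvar mul1r big1 ?addr0 => [|j _].
  by rewrite subSS subn0.
by rewrite scoef_skewvar mul0r.
Qed.

Lemma scoef_skewvarX i k : scoef k (skewvar ^+ i) = (k == i)%:R.
Proof.
elim: i k => [|i IHi] k; first by rewrite expr0 scoef1.
by rewrite exprS scoef_skewvarM; case: k => [|k] //; rewrite IHi rmorph_nat.
Qed.

Lemma skewZMl a f g : (a *: f) * g = a *: (f * g).
Proof.
apply: skewpolyP => k; rewrite scoefZ !scoefM mulr_sumr.
by apply: eq_bigr => i _; rewrite scoefZ mulrA.
Qed.

Lemma skewvarZ a f : skewvar * (a *: f) = sigma a *: (skewvar * f).
Proof.
apply: skewpolyP => k; rewrite scoefZ !scoef_skewvarM.
by case: k => [|k]; rewrite ?mulr0 // scoefZ rmorphM.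
Qed.

Lemma skewvarXZ i a f :
  skewvar ^+ i * (a *: f) = iter i sigma a *: (skewvar ^+ i * f).
Proof.
elim: i => [|i IHi] in a f *; first by rewrite !expr0 !mul1r.
by rewrite exprSr -!mulrA skewvarZ IHi iterSr.
Qed.

End SkewPoly.

(* The pair (x, j) is the variable x(j+1): N^* is represented by nat. *)
Notation lvar X := (X * nat)%type.

Notation Pring K X := {malg K[{cmonom (lvar X)}]}.

Section Shift.
Context (X : countType).
Implicit Types m n : {cmonom (lvar X)}.

Definition shiftm : {cmonom (lvar X)} -> {cmonom (lvar X)} :=
  locked_with skew_key (fun m =>
    [cmonom m (v.1, v.2.-1)
      | v in [fset (u.1, u.2.+1) | u in finsupp m]%fset]%M).

Lemma shiftmE m (x : X) j :
  shiftm m (x, j) = if j is j'.+1 then m (x, j') else 0%N.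
Proof.
rewrite /shiftm unlock cmE fsfun_fun /=; case: imfsetP => [[[y k] /= yk [-> ->]] //|nin].
case: j nin => [//|j] nin; case: (mdomP m (x, j)) => // xj.
by case: nin; exists (x, j).
Qed.

Lemma shiftm1 : shiftm 1%M = 1%M.
Proof.
by apply/eqP/cmP => -[x j]; rewrite shiftmE !cm1; case: j => [|j]; rewrite ?cm1.
Qed.

Lemma shiftmM m n : shiftm (m * n)%M = (shiftm m * shiftm n)%M.
Proof.
by apply/eqP/cmP => -[x j]; rewrite cmM !shiftmE; case: j => [|j]; rewrite ?cmM.
Qed.

Lemma shiftmU (x : X) j : shiftm (ucm (x, j)) = ucm (x, j.+1).
Proof.
apply/eqP/cmP => -[y k]; rewrite shiftmE !ucmE.
case: k => [|k]; first by case: eqP.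
by rewrite ucmE; congr nat_of_bool; apply/eqP/eqP => -[-> ->].
Qed.

Lemma iter_shiftm1 i : iter i (@shiftm) 1%M = 1%M.
Proof. by elim: i => //= i ->; rewrite shiftm1. Qed.
Lemma iter_shiftmM i m n :
  iter i shiftm (m * n)%M = (iter i shiftm m * iter i shiftm n)%M.
Proof. by elim: i => //= i ->; rewrite shiftmM. Qed.
Lemma iter_shiftm_eq1 i m : iter i shiftm m = 1%M -> m = 1%M.
Proof.
elim: i => //= i IHi h; apply: IHi; apply/eqP/cmP => -[x j].
by have := congr1 (fun n : {cmonom (lvar X)} => n (x, j.+1)) h; rewrite shiftmE !cm1.
Qed.

End Shift.

Section Sigma.
Context (K : fieldType) (X : countType).
Implicit Types (c d : K) (m n : {cmonom (lvar X)}).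

(* The term c m of P.  It is locked because the conversion test unfolds
   << _ *g _ >> down to finite maps. *)
Definition pterm : K -> {cmonom (lvar X)} -> Pring K X :=
  locked_with skew_key (fun c m => << c *g m >>).

Lemma ptermE c m : pterm c m = << c *g m >>.
Proof. by rewrite /pterm unlock. Qed.

Lemma coef_pterm c m n : (pterm c m)@_n = c *+ (m == n).
Proof. by rewrite ptermE mcoeffU. Qed.

Lemma ptermM c d m n : pterm c m * pterm d n = pterm (c * d) (m * n)%M.
Proof. by rewrite !ptermE malgM_def fgmulUU. Qed.

Lemma pterm1 : pterm 1 1%M = 1.
Proof. by rewrite ptermE. Qed.

Definition shiftP m : Pring K X := pterm 1 (shiftm m).

Lemma shiftP_mmorphism : mmorphism shiftP.
Proof. by split=> [m n|]; rewrite /shiftP ?shiftm1 ?pterm1 // shiftmM ptermM mulr1. Qed.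
HB.instance Definition _ := isMultiplicative.Build {cmonom (lvar X)} (Pring K X)
  shiftP shiftP_mmorphism.

Definition sigma : Pring K X -> Pring K X :=
  locked_with skew_key
    (mmap (@malgC {cmonom (lvar X)} K : K -> Pring K X) shiftP).

Lemma sigmaE f :
  sigma f = mmap (@malgC {cmonom (lvar X)} K : K -> Pring K X) shiftP f.
Proof. by rewrite /sigma unlock. Qed.

Lemma sigma_is_additive : {morph sigma : f g / f - g}.
Proof. by move=> f g; rewrite !sigmaE rmorphB. Qed.
Lemma sigma_is_multiplicative : multiplicative sigma.
Proof. by split=> [f g|]; rewrite !sigmaE (rmorphM, rmorph1). Qed.
HB.instance Definition _ := GRing.isAdditive.Build (Pring K X) (Pring K X)
  sigma sigma_is_additive.
HB.instance Definition _ := GRing.isMultiplicative.Build (Pring K X) (Pring K X)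
  sigma sigma_is_multiplicative.

Lemma sigma_pterm c m : sigma (pterm c m) = pterm c (shiftm m).
Proof.
rewrite sigmaE [pterm c m]ptermE mmapU /=.
by rewrite -[X in X * _]ptermE ptermM mulr1 mul1m.
Qed.

Lemma sigma_const c : sigma (pterm c 1%M) = pterm c 1%M.
Proof. by rewrite sigma_pterm shiftm1. Qed.

Lemma sigma_var (x : X) j :
  sigma (pterm 1 (ucm (x, j))) = pterm 1 (ucm (x, j.+1)).
Proof. by rewrite sigma_pterm shiftmU. Qed.

Lemma iter_sigma_pterm i c m :
  iter i sigma (pterm c m) = pterm c (iter i (@shiftm X) m).
Proof. by elim: i => // i IHi; rewrite iterS IHi sigma_pterm. Qed.

End Sigma.

Notation Sring K X := (skewpoly (@sigma K X)).

(* The pair (m, i) is the monomial m s^i of Mon(S). *)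
Definition smon (X : countType) : Type := ({cmonom (lvar X)} * nat)%type.

Section SMon.
Context (X : countType).
HB.instance Definition _ := Choice.copy (smon X) ({cmonom (lvar X)} * nat)%type.

Definition smon_one : smon X := (1%M, 0%N).
Definition smon_mul (v w : smon X) : smon X :=
  ((v.1 * iter v.2 (@shiftm X) w.1)%M, (v.2 + w.2)%N).

Fact smon_mulA : associative smon_mul.
Proof.
move=> u v w; congr (_, _); rewrite /= ?addnA //.
by rewrite iter_shiftmM mulmA -iterD.
Qed.
Fact smon_mul1m : left_id smon_one smon_mul.
Proof. by case=> m i; rewrite /smon_mul /= mul1m. Qed.
Fact smon_mulm1 : right_id smon_one smon_mul.
Proof. by case=> m i; rewrite /smon_mul /= iter_shiftm1 mulm1 addn0. Qed.
Fact smon_unitm v w : smon_mul v w = smon_one -> v = smon_one /\ w = smon_one.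
Proof.
case: v w => [m i] [n j] /= [/unitm[-> /iter_shiftm_eq1 ->] /eqP].
by rewrite addn_eq0 => /andP[/eqP-> /eqP->].
Qed.
HB.instance Definition _ := Choice_isMonomialDef.Build (smon X)
  smon_mulA smon_mul1m smon_mulm1 smon_unitm.
End SMon.

Section Defs.
Context (K : fieldType) (X : countType).
Local Notation M := {cmonom (lvar X)}.
Local Notation P := (Pring K X).
Local Notation S := (Sring K X).
Local Notation s := (@skewvar (Pring K X) (@sigma K X) : Sring K X).

Definition monS (w : smon X) : S := pterm 1 w.1 *: s ^+ w.2.

Lemma monSM (v w : smon X) : monS (v * w)%M = monS v * monS w.
Proof.
rewrite /monS skewZMl skewvarXZ scalerA iter_sigma_pterm ptermM mulr1.
by rewrite -exprD.
Qed.

Definition coefS (f : S) (w : smon X) : K := (scoef w.2 f)@_(w.1).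

Record monomial_ordering (lt : rel (smon X)) : Prop := {
  mo_irr : irreflexive lt;
  mo_trans : transitive lt;
  mo_total : forall v w, [\/ lt v w, v = w | lt w v];
  mo_wf : well_founded lt;
  mo_compat : forall p q v w, lt v w -> lt (p * v * q)%M (p * w * q)%M }.

(* R, the K-subalgebra of S generated by the x_i(1) s *)
Inductive inR : set S :=
| inR_const (c : K) : inR (pterm c 1%M *: (1 : S))
| inR_gen (x : X) : inR (pterm 1 (ucm (x, 0%N)) *: s)
| inR_add f g : inR f -> inR g -> inR (f + g)
| inR_mul f g : inR f -> inR g -> inR (f * g).

Record ideal (I : set S) : Prop := {
  ideal_sub : (I `<=` inR)%classic;
  ideal0 : I 0;
  idealD : forall f g, I f -> I g -> I (f + g);
  idealMl : forall r f, inR r -> I f -> I (r * f);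
  idealMr : forall r f, inR r -> I f -> I (f * r) }.

(* The two-sided ideal of R generated by A (for A contained in R) *)
Inductive ideal_gen (A : set S) : set S :=
| ideal_gen0 : ideal_gen A 0
| ideal_genD f r a r' :
    ideal_gen A f -> inR r -> A a -> inR r' -> ideal_gen A (f + r * a * r').

Definition homogeneous (f : S) : Prop := exists (i : nat) (p : P), f = p *: s ^+ i.

Definition graded (I : set S) : Prop :=
  forall f i, I f -> I (scoef i f *: s ^+ i).

Definition homogeneous_basis (I H : set S) : Prop :=
  [/\ (H `<=` I)%classic,
      forall h, H h -> h != 0 /\ homogeneous h &
      ideal_gen H = I].

(* deg_s, for f nonzero homogeneous *)
Definition degs (f : S) : nat := (size (skewval f)).-1.

(* multidegree: d(m)_{k+1} = multideg m k *)
Definition multideg (m : M) (k : nat) : nat :=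
  (\sum_(v <- finsupp m | v.2 == k) m v)%N.

Definition lcmcm (m n : M) : M :=
  [cmonom maxn (m v) (n v) | v in (finsupp m `|` finsupp n)%fset]%M.

Section Ordering.
Variable lt : rel (smon X).

(* Junk value 1 for f = 0 *)
Definition lm (f : S) : smon X :=
  xget 1%M [set w | coefS f w != 0 /\
                    forall v, coefS f v != 0 -> v = w \/ lt v w]%classic.
Definition lc (f : S) : K := coefS f (lm f).

Definition lmset (A : set S) : set S :=
  [set monS (lm f) | f in [set f | A f /\ f != 0]]%classic.

Definition groebner_basis (I G : set S) : Prop :=
  (G `<=` I)%classic /\ ideal_gen (lmset G) = ideal_gen (lmset I).

(* Meaningful when (lm f).2 = (lm g).2 *)
Definition lcm_lm (f g : S) : M := lcmcm (lm f).1 (lm g).1.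

Definition spoly (f g : S) : S :=
  pterm (lc f)^-1 (divcm (lcm_lm f g) (lm f).1) *: f -
  pterm (lc g)^-1 (divcm (lcm_lm f g) (lm g).1) *: g.

(* The multidegree (d(l), i) of spoly f g is of the form (1^d, d) *)
Definition spoly_in_R (f g : S) : Prop :=
  exists d : nat, (lm f).2 = d /\
    forall k, multideg (lcm_lm f g) k = (k < d)%N.

Definition SigmaGSigma (G : set S) : set S :=
  [set h | exists g i j, G g /\ h = s ^+ i * g * s ^+ j]%classic.

Definition red_step (G : set S) (h h' : S) : Prop :=
  h != 0 /\ exists (g : S) (a : M),
    [/\ G g, g != 0, lm h = (((a, 0%N) : smon X) * lm g)%M &
        h' = h - pterm (lc h / lc g) a *: g].

Inductive Reduce (G : set S) : S -> S -> Prop :=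
| Reduce_stop h : (forall h', ~ red_step G h h') -> Reduce G h h
| Reduce_step h h1 h2 : red_step G h h1 -> Reduce G h1 h2 -> Reduce G h h2.

(* The pair (G, B) of the program variables *)
Definition state : Type := (set S * set (S * S))%type.

Definition add_elt (st : state) (h : S) : state :=
  let: (G, B) := st in
  if h == 0 then st else
  (G `|` [set h],
   B `|` [set (h, h)] `|` [set (h, k) | k in G] `|` [set (k, h) | k in G])%classic.

Inductive for_body (F : nat * nat -> S) :
    seq (nat * nat) -> state -> state -> Prop :=
| for_nil st : for_body F [::] st st
| for_cons ij l st h st' :
    Reduce (SigmaGSigma st.1) (F ij) h -> for_body F l (add_elt st h) st' ->
    for_body F (ij :: l) st st'.

(* The indices in D are enumerated in an arbitrary order, without repetition *)
Definition for_loop (D : set (nat * nat)) (F : nat * nat -> S)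
    (st st' : state) : Prop :=
  exists l : seq (nat * nat),
    [/\ uniq l, (forall ij, ij \in l <-> D ij) & for_body F l st st'].

Definition loop1 (f g : S) : state -> state -> Prop :=
  for_loop
    [set ij | (ij.1 + ij.2 + degs g = degs f)%N /\
              spoly_in_R f (s ^+ ij.1 * g * s ^+ ij.2)]%classic
    (fun ij => spoly f (s ^+ ij.1 * g * s ^+ ij.2)).

Definition loop2 (f g : S) : state -> state -> Prop :=
  for_loop
    [set ij | (ij.2 + degs g = degs f + ij.1)%N /\
              spoly_in_R (f * s ^+ ij.1) (s ^+ ij.2 * g)]%classic
    (fun ij => spoly (f * s ^+ ij.1) (s ^+ ij.2 * g)).

Definition while_body (st st' : state) : Prop :=
  exists f g st1, [/\ st.2 (f, g),
    loop1 f g (st.1, (st.2 `\` [set (f, g)])%classic) st1 & loop2 f g st1 st'].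

Inductive while_loop : state -> set S -> Prop :=
| while_stop G : while_loop (G, set0) G
| while_step st st' G :
    while_body st st' -> while_loop st' G -> while_loop st G.

(* FreeGBasis2 H G: some terminating execution on input H returns G *)
Definition FreeGBasis2 (H G : set S) : Prop :=
  while_loop (H, (H `*` H)%classic) G.

End Ordering.
End Defs.

(* Main.v *)
Require Import Defs.
From mathcomp Require Import all_boot all_order all_algebra.
From mathcomp Require Import finmap classical_sets.
From mathcomp Require Import monalg zify.

(** Words embed in Mon(S) through [x l |-> x(1) s * l], and the words are exactly
    the monomials [m s^d] with [m] of multidegree [1^d]. A multiple
    [a s^i g s^j] ([a] in [P], [g] in [R]) whose leading monomial is a word is
    therefore equal to [u g v] with words [u] and [v]: S-polynomials in [R] and
    reduction steps are the ones of the free algebra, and never leave [I].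
    When the algorithm stops, every S-polynomial of two elements of [G] is a
    combination of terms [u g v] that stay below the cancelled monomial. Two
    equal leading monomials [u lm(g) v = u' lm(g') v'] are nested or overlapping
    (an S-polynomial multiplied by words) or disjoint (the product criterion),
    so in a representation of [f] in [I] as a sum of [c u g v] the largest
    monomial can be lowered, by well-foundedness, until it is [lm(f)]. *)

Set Implicit Arguments.
Unset Strict Implicit.
Unset Printing Implicit Defensive.

Import GRing.Theory.

Local Notation "1" := mone : monom_scope.
Local Notation "x * y" := (mmul x y) : monom_scope.

(** * Words as monomials of [Mon(S)], multidegrees and least common multiples *)

Section Words.
Context (X : countType).
Local Notation M := {cmonom (lvar X)}.
Implicit Types (l u v z p q : seq X) (a m n : M).

Definition letterm (x : X) : smon X := (ucm (x, 0%N), 1%N).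

(** Every [s] raises the index of the variables on its right, so the letter in position [k], counted
    from 0, ends up as the variable [(x, k)]. This is the embedding of the free monoid into
    [Mon(S)]. *)
Fixpoint wordm l : smon X :=
  if l is x :: l' then mmul (letterm x) (wordm l') else mone.

Lemma smonM_1 (v w : smon X) :
  (mmul v w).1 = mmul v.1 (iter v.2 (@shiftm X) w.1).
Proof. by []. Qed.

Lemma smonM_2 (v w : smon X) : (mmul v w).2 = (v.2 + w.2)%N.
Proof. by []. Qed.

Lemma wordm_cat u v : wordm (u ++ v) = mmul (wordm u) (wordm v).
Proof. by elim: u => [|x u IHu] /=; rewrite ?mul1m // IHu mulmA. Qed.

Lemma wordm_deg l : (wordm l).2 = size l.
Proof. by elim: l => // x l IHl; rewrite [LHS]smonM_2 IHl. Qed.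

Lemma iter_shiftmE i m (x : X) k :
  iter i (@shiftm X) m (x, k) = if (i <= k)%N then m (x, (k - i)%N) else 0%N.
Proof.
elim: i k => [|i IHi] k; first by rewrite subn0.
by rewrite iterS shiftmE; case: k => // k; rewrite IHi subSS.
Qed.

Lemma wordmE l (x : X) k : (wordm l).1 (x, k) = (onth l k == Some x) :> nat.
Proof.
elim: l k => [|y l IHl] k; first by rewrite [LHS]cm1 onth0n.
rewrite [wordm _]/(mmul _ _) smonM_1 cmM ucmE iter_shiftmE.
case: k => [|k] /=; first by rewrite addn0 xpair_eqE andbT.
by rewrite xpair_eqE andbF add0n subn1 /= IHl.
Qed.

Lemma smon_eqP (v w : smon X) :
  v.2 = w.2 -> (forall x k, v.1 (x, k) = w.1 (x, k)) -> v = w.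
Proof.
case: v w => [m i] [n j] /= -> mn; congr (_, _).
by apply/eqP/cmP => -[x k].
Qed.

Lemma wordm_inj : injective wordm.
Proof.
move=> u v uv; apply: eq_from_onth => k.
have E x : (onth u k == Some x) = (onth v k == Some x).
  have := wordmE u x k; rewrite uv wordmE.
  by case: (onth u k == _); case: (onth v k == _).
case Eu: (onth u k) => [x|]; first by apply/esym/eqP; rewrite -E Eu.
by case Ev: (onth v k) => [x|] //; move: (E x); rewrite Eu Ev eqxx.
Qed.

(** This is the leading monomial of [s^i g s^j] when [lm g] is the word [l]: the letters of [l]
    occupy the positions from [i] on, with [i] free places before them and [j] after. *)
Definition shiftword i l j : smon X :=
  mmul (mmul ((mone, i) : smon X) (wordm l)) ((mone, j) : smon X).

Lemma mul_shiftwordE a i l j (x : X) (k : nat) :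
  (mmul ((a, 0%N) : smon X) (shiftword i l j)).1 (x, k) =
  (a (x, k) + ((i <= k) && (onth l (k - i) == Some x)))%N.
Proof.
transitivity (a (x, k) + (shiftword i l j).1 (x, k))%N; first exact: cmM.
rewrite /shiftword !smonM_1 mul1m cmM iter_shiftm1 cm1 addn0 iter_shiftmE wordmE.
by case: (i <= k)%N.
Qed.

Lemma mul_shiftword_deg a i l j :
  (mmul ((a, 0%N) : smon X) (shiftword i l j)).2 = (i + size l + j)%N.
Proof. by rewrite !smonM_2 wordm_deg. Qed.

Lemma shiftwordE p l q (x : X) (k : nat) :
  (shiftword (size p) l (size q)).1 (x, k) =
  (size p <= k < size p + size l) && (onth (p ++ l ++ q) k == Some x) :> nat.
Proof.
have := mul_shiftwordE mone (size p) l (size q) x k.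
rewrite [mmul _ _](mul1m _) cm1 => ->.
rewrite !onth_cat add0n; case: (leqP (size p) k) => //= le_pk.
have -> : (k - size p < size l)%N = (k < size p + size l)%N by lia.
by case: ltnP => //= le_k; rewrite onth_default //; lia.
Qed.

(* Every variable of [a] has an index outside the positions occupied by [l],
   because a word uses each index once. *)
Lemma shiftword_factor a i l j z :
  mmul ((a, 0%N) : smon X) (shiftword i l j) = wordm z ->
  exists p q, [/\ z = p ++ l ++ q, size p = i, size q = j &
    forall w : seq X, size w = size l ->
      mmul ((a, 0%N) : smon X) (shiftword i w j) = wordm (p ++ w ++ q)].
Proof.
move=> Ez; have szz : size z = (i + size l + j)%N.
  by rewrite -wordm_deg -Ez mul_shiftword_deg.
have Ek x k := mul_shiftwordE a i l j x k.
have {}Ek x k : (a (x, k) + ((i <= k) && (onth l (k - i) == Some x)))%N =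
                (onth z k == Some x).
  by rewrite -Ek Ez wordmE.
pose p := take i z; pose r := take (size l) (drop i z).
pose q := drop (size l) (drop i z).
have zE : z = p ++ r ++ q by rewrite !cat_take_drop.
have szp : size p = i by rewrite size_take_min szz; apply/minn_idPl; lia.
have szr : size r = size l by rewrite size_take_min size_drop szz; lia.
have szq : size q = j by rewrite !size_drop szz; lia.
(* At an index occupied by [l] the left side of [Ek] is at least 1 and the right side at most 1, so
   the letters of [z] and [l] agree there. *)
have rE : r = l.
  apply: eq_from_onth_le => k; rewrite szr maxnn => lt_k.
  have: onth l k by rewrite onthTE.
  case El: (onth l k) => [x|] // _.
  have := Ek x (i + k)%N; rewrite leq_addr addKn El eqxx addn1.
  rewrite zE !onth_cat szp szr addKn lt_k ltnNge leq_addr /=.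
  by case: eqP.
exists p, q; split=> //; first by rewrite -rE.
move=> w szw; apply: smon_eqP => [|x k].
  by rewrite mul_shiftword_deg wordm_deg !size_cat szp szq addnA.
rewrite mul_shiftwordE wordmE; have := Ek x k; rewrite zE rE !onth_cat szp szw.
case: leqP => //= le_ik; rewrite ?addn0 //.
(* Inside the block, [Ek] now forces the exponent of [a] to be 0, so any word of the same length may
   take the place of [l]. *)
case: ltnP => [_|le_k]; first by case: (_ == _) (_ == _) => [] [] //=; lia.
by rewrite !(@onth_default _ (k - i)) ?szw //= addn0.
Qed.

Lemma multideg_option m k (o : option X) :
  (forall x, m (x, k) = (o == Some x) :> nat) -> multideg m k = o :> nat.
Proof.
move=> mk; rewrite /multideg; case: o mk => [x|] mk; last first.
  by rewrite big1_seq // => -[y k'] /andP[/eqP/= -> _]; rewrite mk.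
have xk : (x, k) \in finsupp m by rewrite -cmE_neq0 mk eqxx.
rewrite big_mkcond (bigD1_seq (x, k)) ?fset_uniq //= eqxx mk eqxx /=.
rewrite big1 // => -[y k']; case: ifP => //= /eqP -> neq; rewrite mk.
by case: (Some x =P Some y) neq => // -[->]; rewrite eqxx.
Qed.

Lemma multideg_wordm z k : multideg (wordm z).1 k = (k < size z)%N.
Proof.
by rewrite (@multideg_option _ _ (onth z k)) ?onthTE // => x; exact: wordmE.
Qed.

(** A sum of natural numbers that is at most 1 has at most one nonzero term, and that term is 1:
    index [k] carries at most one letter. *)
Lemma multideg_bool m k (b : bool) : multideg m k = b ->
  exists2 o : option X, b = o & forall x, m (x, k) = (o == Some x) :> nat.
Proof.
case: b => [mk|mk]; last first.
  exists None => // x; apply/eqP; rewrite cmE_eq0; apply/negP => xk.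
  move/eqP: mk; rewrite sum_nat_seq_eq0 => /allP/(_ _ xk); rewrite eqxx /=.
  by rewrite cmE_eq0 xk.
have /hasP[[x k'] xk /andP[/eqP/= ? mx]] :
    has (fun v : lvar X => (v.2 == k) && (m v != 0)%N) (finsupp m).
  apply/negPn/negP => /hasPn h; move: mk; rewrite /multideg big1_seq //.
  by move=> v /andP[vk /h]; rewrite vk negbK => /eqP.
subst k'; exists (Some x) => // y.
move: mk; rewrite /multideg big_mkcond (bigD1_seq (x, k)) ?fset_uniq //= eqxx.
have [<-|neq] := eqVneq x y.
  by rewrite eqxx; case: (m (x, k)) mx => [|[|t]].
case: (m (x, k)) mx => [|[|t]] // _ [/eqP]; rewrite sum_nat_seq_eq0 => h.
have -> : (Some x == Some y) = false by apply/eqP => -[/eqP]; apply/negP.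
apply/eqP; rewrite cmE_eq0; apply/negP => yk.
move/allP/(_ _ yk): h; rewrite /= eqxx xpair_eqE eqxx andbT eq_sym neq /=.
by rewrite cmE_eq0 yk.
Qed.

(** The monomial form of [R_d = P_{1^d} s^d]: each index below [d] carries exactly one letter, and
    these letters, read in order, form the word. *)
Lemma multideg_word m d : (forall k, multideg m k = (k < d)%N) ->
  exists z, wordm z = (m, d).
Proof.
move=> md; have {}md k := multideg_bool (md k).
have [z szz zE] : exists2 z, size z = d &
    forall k x, (k < d)%N -> m (x, k) = (onth z k == Some x).
  (* The letters are only known to exist index by index; induction on a prefix of length [n]
     collects them. *)
  suff: forall n : nat, (n <= d)%N -> exists2 z, size z = n &
    forall k x, (k < n)%N -> m (x, k) = (onth z k == Some x) by apply.
  elim=> [|n IHn] le_nd; first by exists [::].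
  have [z szz zE] := IHn (ltnW le_nd); have [o] := md n.
  rewrite le_nd; case: o => // y _ oE; exists (rcons z y).
    by rewrite size_rcons szz.
  move=> k x; rewrite ltnS leq_eqVlt -cats1 onth_cat szz => /predU1P[->|lt_k].
    by rewrite ltnn subnn oE.
  by rewrite lt_k zE.
exists z; apply: smon_eqP => [|x k]; first by rewrite wordm_deg.
rewrite wordmE; have [lt_k|le_k] := ltnP k d; first by rewrite zE.
rewrite onth_default ?szz //; have [o] := md k.
by rewrite ltnNge le_k /=; case: o => // _ ->.
Qed.

Lemma lcmcmE m n (v : lvar X) : lcmcm m n v = maxn (m v) (n v).
Proof.
rewrite /lcmcm cmE fsfun_fun; case: ifPn => //; rewrite inE negb_or.
by rewrite -!cmE_eq0 => /andP[/eqP-> /eqP->].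
Qed.

Lemma lcmcmC m n : lcmcm m n = lcmcm n m.
Proof. by apply/eqP/cmP => v; rewrite !lcmcmE maxnC. Qed.

Lemma divcm_lcmK m n : mmul (divcm (lcmcm m n) m) m = lcmcm m n.
Proof.
by apply/eqP/cmP => v; rewrite cmM divcmE subnK // lcmcmE leq_maxl.
Qed.

(** Supplies the hypothesis of [shiftword_factor] for the cofactor in an S-polynomial whose least
    common multiple is a word. *)
Lemma divcm_lcm_shiftword i l j n z :
  lcmcm (shiftword i l j).1 n = (wordm z).1 -> size z = (i + size l + j)%N ->
  mmul ((divcm (lcmcm (shiftword i l j).1 n) (shiftword i l j).1, 0%N) : smon X)
    (shiftword i l j) = wordm z.
Proof.
move=> Ez szz; apply: smon_eqP => [|x k].
  by rewrite mul_shiftword_deg wordm_deg.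
by rewrite -Ez -[in RHS]divcm_lcmK.
Qed.

(** One block starts at the left end, one stops at the right end, and the two inequalities exclude a
    gap between them. The blocks thus cover the whole word, and where they overlap they carry the
    same letters. *)
Lemma lcmcm_shiftword p l q p' l' q' :
  p ++ l ++ q = p' ++ l' ++ q' ->
  (size p = 0 \/ size p' = 0)%N -> (size q = 0 \/ size q' = 0)%N ->
  (size p <= size p' + size l')%N -> (size p' <= size p + size l)%N ->
  lcmcm (shiftword (size p) l (size q)).1 (shiftword (size p') l' (size q')).1 =
  (wordm (p ++ l ++ q)).1.
Proof.
move=> Ez p0 q0 le1 le2; apply/eqP/cmP => -[x k].
rewrite lcmcmE !shiftwordE wordmE -Ez.
have := congr1 size Ez; rewrite !size_cat => sz.
have [lt_k|le_k] := ltnP k (size (p ++ l ++ q)); last first.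
  by rewrite onth_default //= !andbF.
move: lt_k; rewrite !size_cat => lt_k.
by case: (_ == _); rewrite ?andbF // !andbT; lia.
Qed.

End Words.

(** * Coefficients on the monomial basis of [S] and two-sided multiplication by monomials *)

Section Coefficients.
Context (K : fieldType) (X : countType).
Local Notation M := {cmonom (lvar X)}.
Local Notation S := (Sring K X).
Local Open Scope ring_scope.
Implicit Types (c d : K) (f g h : S) (u v w : smon X) (a : M).

Definition kscale c f : S := pterm c 1%M *: f.

Lemma coefS0 w : coefS (0 : S) w = 0.
Proof. by rewrite /coefS scoef0 mcoeff0. Qed.

Lemma coefSD f g w : coefS (f + g) w = coefS f w + coefS g w.
Proof. by rewrite /coefS scoefD mcoeffD. Qed.

Lemma coefSN f w : coefS (- f) w = - coefS f w.
Proof. by rewrite /coefS scoefN mcoeffN. Qed.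

Lemma coefSB f g w : coefS (f - g) w = coefS f w - coefS g w.
Proof. by rewrite coefSD coefSN. Qed.

Lemma coefSZ c f w : coefS (kscale c f) w = c * coefS f w.
Proof. by rewrite /coefS scoefZ ptermE mcoeffCM. Qed.

Lemma coefS_monS v w : coefS (monS K v) w = (v == w)%:R.
Proof.
case: v w => [m i] [n j]; rewrite /coefS /monS scoefZ scoef_skewvarX /=.
rewrite mulr_natr mcoeffMn coef_pterm [in RHS]xpair_eqE [j == i]eq_sym.
by case: (i == j); case: (m == n).
Qed.

Lemma coefS_inj f g : coefS f =1 coefS g -> f = g.
Proof.
by move=> fg; apply: skewpolyP => k; apply/malgP => m; exact: (fg (m, k)).
Qed.

Lemma coefS_sum (r : seq (smon X)) (F : smon X -> S) w :
  coefS (\sum_(v <- r) F v) w = \sum_(v <- r) coefS (F v) w.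
Proof.
by apply: (big_morph (fun f => coefS f w)) => [f g|]; rewrite (coefSD, coefS0).
Qed.

Definition suppS f : seq (smon X) :=
  undup [seq (m, i) | i <- iota 0 (size (skewval f)),
                      m <- enum_fset (msupp (scoef i f))].

Lemma mem_suppS f w : coefS f w != 0 -> w \in suppS f.
Proof.
case: w => m i; rewrite /coefS /= => fmi; rewrite mem_undup.
apply/allpairsPdep; exists i, m; split=> //; last by rewrite -mcoeff_neq0.
rewrite mem_iota /= add0n ltnNge; apply: contraNN fmi => szi.
by rewrite /scoef nth_default // mcoeff0.
Qed.

(** Reduces statements about products in [S] to monomials, where [monSM] computes. *)
Lemma coefS_expand f : f = \sum_(w <- suppS f) kscale (coefS f w) (monS K w).
Proof.
apply: coefS_inj => v; rewrite coefS_sum.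
have E w : coefS (kscale (coefS f w) (monS K w)) v = coefS f w *+ (w == v).
  by rewrite coefSZ coefS_monS mulr_natr.
rewrite (eq_bigr _ (fun w _ => E w)).
have [fv0|/mem_suppS vf] := eqVneq (coefS f v) 0.
  by rewrite fv0 big1 // => w _; case: eqP => // ->; rewrite fv0 mul0rn.
rewrite (bigD1_seq v) ?undup_uniq //= eqxx mulr1n big1 ?addr0 // => w.
by move=> /negbTE->; rewrite mulr0n.
Qed.

Lemma kscale0 c : kscale c 0 = 0. Proof. exact: scaler0. Qed.
Lemma kscale0l f : kscale 0 f = 0.
Proof. by apply: coefS_inj => w; rewrite coefSZ mul0r coefS0. Qed.
Lemma kscale1 f : kscale 1 f = f.
Proof. by rewrite /kscale pterm1 scale1r. Qed.
Lemma kscaleD c : {morph kscale c : f g / f + g}.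
Proof. by move=> f g; exact: scalerDr. Qed.
Lemma kscaleB c : {morph kscale c : f g / f - g}.
Proof. by move=> f g; exact: scalerBr. Qed.
Lemma kscaleDl f c d : kscale (c + d) f = kscale c f + kscale d f.
Proof. by apply: coefS_inj => w; rewrite coefSD !coefSZ mulrDl. Qed.
Lemma kscaleN f : kscale (-1) f = - f.
Proof. by apply: coefS_inj => w; rewrite coefSN coefSZ mulN1r. Qed.
Lemma kscaleA c d f : kscale c (kscale d f) = kscale (c * d) f.
Proof. by apply: coefS_inj => w; rewrite !coefSZ mulrA. Qed.
Lemma kscaleMl c f g : kscale c f * g = kscale c (f * g).
Proof. exact: skewZMl. Qed.
Lemma monSZ c u f : monS K u * kscale c f = kscale c (monS K u * f).
Proof.
rewrite /monS /kscale !skewZMl skewvarXZ iter_sigma_pterm iter_shiftm1.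
by rewrite !scalerA mulrC.
Qed.

Lemma monS1 : monS K (mone : smon X) = 1.
Proof. by rewrite /monS pterm1 scale1r. Qed.

Definition sandwich u f v : S := monS K u * f * monS K v.

Lemma sandwichD u v : {morph sandwich u ^~ v : f g / f + g}.
Proof. by move=> f g; rewrite /sandwich mulrDr mulrDl. Qed.
Lemma sandwichB u v : {morph sandwich u ^~ v : f g / f - g}.
Proof. by move=> f g; rewrite /sandwich mulrBr mulrBl. Qed.
Lemma sandwich0 u v : sandwich u 0 v = 0.
Proof. by rewrite /sandwich mulr0 mul0r. Qed.
Lemma sandwichZ u c f v : sandwich u (kscale c f) v = kscale c (sandwich u f v).
Proof. by rewrite /sandwich monSZ kscaleMl. Qed.
Lemma sandwich1 f : sandwich mone f mone = f.
Proof. by rewrite /sandwich monS1 mul1r mulr1. Qed.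
Lemma sandwichA u u' f v v' :
  sandwich u (sandwich u' f v') v = sandwich (mmul u u') f (mmul v' v).
Proof. by rewrite /sandwich !monSM !mulrA. Qed.

Lemma sandwich_expand u f v : sandwich u f v =
  \sum_(w <- suppS f) kscale (coefS f w) (monS K (mmul (mmul u w) v)).
Proof.
rewrite {1}[f]coefS_expand /sandwich mulr_sumr mulr_suml.
by apply: eq_bigr => w _; rewrite monSZ kscaleMl !monSM.
Qed.

Lemma skewvarXE i : (skewvar (@sigma K X) : S) ^+ i = monS K ((1%M, i) : smon X).
Proof. by rewrite /monS pterm1 scale1r. Qed.

Lemma ptermZ c a f : pterm c a *: f = kscale c (monS K ((a, 0%N) : smon X) * f).
Proof.
rewrite /kscale /monS /= expr0 skewZMl mul1r scalerA.
by rewrite ptermM mulr1 mul1m.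
Qed.

Lemma coefS_sandwich_neq0 u f v w : coefS (sandwich u f v) w != 0 ->
  exists2 w', coefS f w' != 0 & w = mmul (mmul u w') v.
Proof.
move=> fw; have: exists2 w', w' \in suppS f &
    coefS (kscale (coefS f w') (monS K (mmul (mmul u w') v))) w != 0.
  apply/hasP; apply: contraNT fw => /hasPn h.
  rewrite sandwich_expand coefS_sum big1_seq // => w' /andP[_ /h].
  by rewrite negbK => /eqP.
case=> w' _; rewrite coefSZ coefS_monS mulf_eq0 negb_or => /andP[fw' neq].
by exists w' => //; apply/eqP; apply: contraNT neq; rewrite eq_sym => /negbTE->.
Qed.

(** The hypothesis prevents another monomial of [f] from landing on the same product; a monomial
    ordering provides it through [mulm_inj]. *)
Lemma coefS_sandwich u f v w : (forall w', mmul (mmul u w') v =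
    mmul (mmul u w) v -> w' = w) ->
  coefS (sandwich u f v) (mmul (mmul u w) v) = coefS f w.
Proof.
move=> inj; rewrite sandwich_expand coefS_sum [in RHS](coefS_expand f) coefS_sum.
apply: eq_bigr => w' _; rewrite !coefSZ !coefS_monS; congr (_ * _%:R).
by congr nat_of_bool; apply/eqP/eqP => [/inj|->].
Qed.

(** Only the products with monomials of [f] matter. This allows [a s^i f s^j] to equal [u f v] with
    words [u], [v], although the outer factors differ. *)
Lemma eq_sandwich u v u' v' f :
  (forall w, coefS f w != 0 -> mmul (mmul u w) v = mmul (mmul u' w) v') ->
  sandwich u f v = sandwich u' f v'.
Proof.
move=> E; rewrite !sandwich_expand; apply: eq_bigr => w _.
by have [->|/E->] := eqVneq (coefS f w) 0; rewrite ?kscale0l.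
Qed.

End Coefficients.

(** * Elements of [R] as linear combinations of words *)

Section WordPolynomials.
Context (K : fieldType) (X : countType).
Local Notation S := (Sring K X).
Local Open Scope ring_scope.
Implicit Types (c : K) (f g h r : S) (l p q : seq X) (w : smon X) (d : nat).

Definition wsandwich p f q : S := sandwich (wordm p) f (wordm q).

(* Membership in the component [R_d], read off the monomials. *)
Definition Rhom d f : Prop :=
  forall w, coefS f w != 0 -> exists2 l, size l = d & w = wordm l.

Lemma inR_wordm l : inR (monS K (wordm l)).
Proof.
elim: l => [|x l IHl].
  by rewrite monS1 -[X in inR X]scale1r -pterm1; exact: inR_const.
by rewrite [wordm _]/(mmul _ _) monSM; apply: inR_mul => //; exact: inR_gen.
Qed.

Lemma coefSM f g w : coefS (f * g) w != 0 ->
  exists u v, [/\ coefS f u != 0, coefS g v != 0 & w = mmul u v].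
Proof.
move=> fgw; have /hasP[u _] :
    has (fun u => coefS (kscale (coefS f u) (sandwich u g mone)) w != 0)
      (suppS f).
  apply: contraNT fgw => /hasPn h.
  rewrite [f]coefS_expand mulr_suml coefS_sum big1_seq // => u /andP[_ /h].
  by rewrite negbK /sandwich monS1 mulr1 kscaleMl => /eqP.
rewrite coefSZ mulf_eq0 negb_or => /andP[fu /coefS_sandwich_neq0[v gv ->]].
by exists u, v; split=> //; rewrite mulm1.
Qed.

(** The generators satisfy this, sums preserve it, and products preserve it because words
    concatenate. *)
Lemma inR_coefS f w : inR f -> coefS f w != 0 -> exists l, w = wordm l.
Proof.
move=> Rf; elim: Rf w => {f} [c|x|f g _ IHf _ IHg|f g _ IHf _ IHg] w.
- rewrite -[_ *: _]/(kscale c 1) -(monS1 K X) coefSZ coefS_monS.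
  by case: (mone =P w) => [<- _|_]; [exists [::] | rewrite mulr0 eqxx].
- rewrite -[_ *: _]/(monS K (letterm x)) coefS_monS.
  by case: (letterm x =P w) => [<- _|_];
    [exists [:: x]; rewrite /= mulm1 | rewrite eqxx].
- rewrite coefSD => fgw; have [fw|/IHf//] := eqVneq (coefS f w) 0.
  by apply: IHg; rewrite fw add0r in fgw.
- by move=> /coefSM[u [v [/IHf[l ->] /IHg[l' ->] ->]]]; exists (l ++ l');
    rewrite wordm_cat.
Qed.

Lemma RhomD d f g : Rhom d f -> Rhom d g -> Rhom d (f + g).
Proof.
move=> Rf Rg w; rewrite coefSD => fgw.
have [fw|/Rf//] := eqVneq (coefS f w) 0.
by apply: Rg; rewrite fw add0r in fgw.
Qed.

Lemma RhomZ d c f : Rhom d f -> Rhom d (kscale c f).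
Proof. by move=> Rf w; rewrite coefSZ mulf_eq0 negb_or => /andP[_ /Rf]. Qed.

Lemma RhomB d f g : Rhom d f -> Rhom d g -> Rhom d (f - g).
Proof. by move=> Rf Rg; rewrite -kscaleN; apply/RhomD/RhomZ. Qed.

Lemma Rhom_wsandwich d p f q :
  Rhom d f -> Rhom (size p + d + size q) (wsandwich p f q).
Proof.
move=> Rf w /coefS_sandwich_neq0[v /Rf[l <- ->] ->].
by exists (p ++ l ++ q); rewrite ?size_cat ?addnA // !wordm_cat mulmA.
Qed.

(** The [s]-degree of a word is its length, so homogeneity in [s] fixes the length of all words of
    [f]. *)
Lemma inR_homogeneous_Rhom f : inR f -> homogeneous f -> exists d, Rhom d f.
Proof.
move=> Rf [i [p fE]]; exists i => w fw; have [l wE] := inR_coefS Rf fw.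
exists l => //; rewrite -wordm_deg -wE; apply: contraNeq fw => /negbTE ne.
by rewrite fE /coefS scoefZ scoef_skewvarX ne mulr0 mcoeff0.
Qed.

Lemma scoef_Rhom d f k : Rhom d f -> k != d -> scoef k f = 0.
Proof.
move=> Rf; apply: contraNeq => fk.
have [m fkm] : exists m, (scoef k f)@_m != 0.
  have [e|] := eqVneq (msupp (scoef k f)) fset0.
    by move: fk; rewrite -msupp_eq0 e eqxx.
  by move=> /fset0Pn[m]; rewrite -mcoeff_neq0; exists m.
have [l <- /(congr1 snd)] := Rf (m, k) fkm.
by rewrite wordm_deg /= => ->.
Qed.

Lemma Rhom_homogeneous d f : Rhom d f -> homogeneous f.
Proof.
move=> Rf; exists d, (scoef d f); apply: skewpolyP => k.
rewrite scoefZ scoef_skewvarX; case: eqP => [->|/eqP ne]; first by rewrite mulr1.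
by rewrite mulr0 (scoef_Rhom Rf).
Qed.

Lemma degs_Rhom d f : Rhom d f -> f != 0 -> degs f = d.
Proof.
move=> Rf f0; have f0' : skewval f != 0.
  by apply: contraNneq f0 => h; apply/eqP/val_inj; rewrite /= h skewzeroE.
apply: contra_neq_eq f0' => ne; apply/eqP; rewrite -lead_coef_eq0 /lead_coef.
by rewrite -/(scoef _ _) (scoef_Rhom Rf).
Qed.

Lemma ideal_kscale (I : set S) c f : ideal I -> I f -> I (kscale c f).
Proof.
move=> idI If; rewrite -[f]mul1r -kscaleMl.
exact: (Defs.idealMl idI (inR_const _ _)).
Qed.

Lemma ideal_sub_closed (I : set S) f g : ideal I -> I f -> I g -> I (f - g).
Proof.
move=> idI If Ig; apply: (idealD idI If).
by rewrite -kscaleN; exact: ideal_kscale.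
Qed.

Lemma ideal_wsandwich (I : set S) p f q :
  ideal I -> I f -> I (wsandwich p f q).
Proof.
move=> idI If; rewrite /wsandwich /sandwich.
apply: (Defs.idealMr idI (inR_wordm _)).
exact: (Defs.idealMl idI (inR_wordm _)).
Qed.

End WordPolynomials.

(** * Leading monomials and combinations with bounded terms *)

Section Leading.
Context (K : fieldType) (X : countType) (lt : rel (smon X)).
Context (mo : monomial_ordering lt).
Local Notation S := (Sring K X).
Local Open Scope ring_scope.
Local Notation lm := (lm lt).
Local Notation lc := (lc lt).
Implicit Types (c : K) (f g h r : S) (l p q : seq X) (u v w : smon X) (d : nat).
Implicit Types (G : set S) (Q : smon X -> Prop).

(** Distinct monomials are comparable, and compatibility keeps their products strictly
    comparable. *)
Lemma mulm_inj u v : injective (fun w => mmul (mmul u w) v).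
Proof.
move=> w w' /= E; have irr t := mo_irr mo t.
case: (mo_total mo w w') => // /(mo_compat mo u v); rewrite E irr //.
Qed.

(** Ensures that the [xget] defining [lm] does not return its default value on a nonzero [f]. *)
Lemma lm_exists f : f != 0 ->
  exists w, coefS f w != 0 /\ forall v, coefS f v != 0 -> v = w \/ lt v w.
Proof.
move=> f0; have max_seq (s : seq (smon X)) : s = [::] \/
    exists2 w, w \in s & forall v, v \in s -> v = w \/ lt v w.
  elim: s => [|w s IHs]; [by left | right].
  case: IHs => [->|[w' w's max_w']].
    by exists w; rewrite ?mem_head // => v; rewrite inE => /eqP; left.
  case: (mo_total mo w w') => [lt_w|->|lt_w].
  - exists w'; rewrite ?inE ?w's ?orbT // => v.
    by rewrite inE => /predU1P[->|/max_w']; [right|].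
  - exists w'; rewrite ?mem_head // => v.
    by rewrite inE => /predU1P[->|/max_w']; [left|].
  exists w; rewrite ?mem_head // => v; rewrite inE => /predU1P[->|].
    by left.
  by case/max_w' => [->|lt_v]; right => //; apply: (mo_trans mo) lt_w.
case: (max_seq [seq w <- suppS f | coefS f w != 0]) => [s0|[w]].
  case/eqP: f0; apply: coefS_inj => w; rewrite coefS0; apply: contraTeq isT => fw.
  by have := mem_filter (fun w => coefS f w != 0) w (suppS f);
    rewrite s0 fw mem_suppS.
rewrite mem_filter => /andP[fw _] max_w; exists w; split=> // v fv.
by apply: max_w; rewrite mem_filter fv mem_suppS.
Qed.

Lemma lmP f : f != 0 -> coefS f (lm f) != 0 /\
  forall v, coefS f v != 0 -> v = lm f \/ lt v (lm f).
Proof. by move=> f0; have := xgetPex 1%M (lm_exists f0). Qed.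

Lemma lc_neq0 f : f != 0 -> lc f != 0. Proof. by case/lmP. Qed.

Lemma lm_unique f w : coefS f w != 0 ->
  (forall v, coefS f v != 0 -> v = w \/ lt v w) -> lm f = w.
Proof.
move=> fw max_w; have f0 : f != 0 by apply: contraNneq fw => ->; rewrite coefS0.
have [flm max_lm] := lmP f0.
case: (max_w _ flm) => // lt1; case: (max_lm _ fw) => // lt2.
by have := mo_trans mo lt1 lt2; rewrite (mo_irr mo).
Qed.

Lemma coefS_sandwichE u f v w :
  coefS (sandwich u f v) (mmul (mmul u w) v) = coefS f w.
Proof. by apply: coefS_sandwich => w' /mulm_inj. Qed.

Lemma lm_sandwich u f v : f != 0 ->
  lm (sandwich u f v) = mmul (mmul u (lm f)) v.
Proof.
case/lmP => fw max_w; apply: lm_unique; first by rewrite coefS_sandwichE.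
move=> _ /coefS_sandwich_neq0[w /max_w[->|lt_w] ->]; [by left | right].
exact: (mo_compat mo).
Qed.

Lemma lc_sandwich u f v : f != 0 -> lc (sandwich u f v) = lc f.
Proof. by move=> f0; rewrite /lc lm_sandwich // coefS_sandwichE. Qed.

Lemma sandwich_neq0 u f v : f != 0 -> sandwich u f v != 0.
Proof.
move=> f0; have := lc_neq0 f0; apply: contraNneq => e.
by rewrite -(lc_sandwich u v f0) e /lc coefS0.
Qed.

(** Stated on all monomials of [f] rather than on [lm f], so that it holds for [f = 0] and passes to
    sums without case distinctions. *)
Definition lmlt w f : Prop := forall v, coefS f v != 0 -> lt v w.

Lemma lmltD w f g : lmlt w f -> lmlt w g -> lmlt w (f + g).
Proof.
move=> fw gw v; rewrite coefSD => fgv.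
have [fv|/fw//] := eqVneq (coefS f v) 0.
by apply: gw; rewrite fv add0r in fgv.
Qed.

Lemma lmltZ w c f : lmlt w f -> lmlt w (kscale c f).
Proof. by move=> fw v; rewrite coefSZ mulf_eq0 negb_or => /andP[_ /fw]. Qed.

Lemma lmltB w f g : lmlt w f -> lmlt w g -> lmlt w (f - g).
Proof. by move=> fw gw; rewrite -kscaleN; apply/lmltD/lmltZ. Qed.

Lemma lmlt_lm w f : f != 0 -> lmlt w f -> lt (lm f) w.
Proof. by case/lmP => + _ fw; exact: fw. Qed.

Lemma lm_lmlt w f : lt (lm f) w -> lmlt w f.
Proof.
move=> lt_w v fv; have f0 : f != 0 by apply: contraNneq fv => ->; rewrite coefS0.
by case/lmP: f0 => _ /(_ _ fv)[->|lt_v] //; apply: (mo_trans mo) lt_w.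
Qed.

Lemma lmlt_cancel f g : f != 0 -> g != 0 -> lm f = lm g ->
  lmlt (lm f) (kscale (lc f)^-1 f - kscale (lc g)^-1 g).
Proof.
move=> f0 g0 E v; rewrite coefSB !coefSZ; have [-> /eqP[]|ne] := eqVneq v (lm f).
  by rewrite -/(lc f) [in coefS g _]E -/(lc g) !mulVf ?subrr // lc_neq0.
have [fv|fv] := eqVneq (coefS f v) 0; last first.
  by case/lmP: f0 => _ /(_ _ fv)[] // vE; rewrite vE eqxx in ne.
have [gv|gv] := eqVneq (coefS g v) 0; first by rewrite fv gv !mulr0 subrr eqxx.
by case/lmP: g0 => _ /(_ _ gv); rewrite -E => -[] // vE; rewrite vE eqxx in ne.
Qed.

(** Finite sums of terms [c u g v] with words [u], [v] and [Q] imposed on the leading monomial of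
    each [u g v]. Taking [lt v w] for [Q] gives representations strictly below [w]; taking [True]
    leaves the terms unbounded. *)
Inductive std G Q : S -> Prop :=
| std0 : std G Q 0
| stdS f c g p q : std G Q f -> G g ->
    Q (mmul (mmul (wordm p) (lm g)) (wordm q)) ->
    std G Q (f + kscale c (wsandwich p g q)).

Lemma stdD G Q f g : std G Q f -> std G Q g -> std G Q (f + g).
Proof.
move=> sf; elim=> [|h c k p q _ IHh Gk Qk]; first by rewrite addr0.
by rewrite addrA; exact: stdS.
Qed.

Lemma stdZ G Q c f : std G Q f -> std G Q (kscale c f).
Proof.
elim=> [|h d k p q _ IHh Gk Qk]; first by rewrite kscale0; exact: std0.
by rewrite kscaleD kscaleA; exact: stdS.
Qed.

Lemma stdB G Q f g : std G Q f -> std G Q g -> std G Q (f - g).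
Proof. by move=> sf sg; rewrite -kscaleN; apply/stdD/stdZ. Qed.

Lemma std_term G Q c g p q : G g ->
  Q (mmul (mmul (wordm p) (lm g)) (wordm q)) ->
  std G Q (kscale c (wsandwich p g q)).
Proof.
by move=> Gg Qg; rewrite -[kscale _ _]add0r; apply: stdS => //; exact: std0.
Qed.

Lemma std_mem (G : set S) Q g : G g -> Q (lm g) -> std G Q g.
Proof.
move=> Gg Qg; rewrite -[g]sandwich1 -[sandwich _ _ _]kscale1.
by apply: (@std_term _ _ _ _ [::] [::]) => //=; rewrite mul1m mulm1.
Qed.

Lemma std_sub (G G' : set S) Q (Q' : smon X -> Prop) f : (G `<=` G')%classic ->
  (forall w, Q w -> Q' w) -> std G Q f -> std G' Q' f.
Proof.
move=> sGG' sQQ'; elim=> [|h d k p q _ IHh Gk Qk]; first exact: std0.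
by apply: stdS => //; [exact: sGG' | exact: sQQ'].
Qed.

Lemma std_wsandwich G Q (Q' : smon X -> Prop) p f q :
  (forall w, Q w -> Q' (mmul (mmul (wordm p) w) (wordm q))) ->
  std G Q f -> std G Q' (wsandwich p f q).
Proof.
move=> sQQ'; elim=> [|h d k p' q' _ IHh Gk Qk].
  by rewrite /wsandwich sandwich0; exact: std0.
rewrite /wsandwich sandwichD sandwichZ sandwichA -!wordm_cat.
apply: stdS => //; rewrite !wordm_cat.
have -> : mmul (mmul (mmul (wordm p) (wordm p')) (lm k))
    (mmul (wordm q') (wordm q)) =
  mmul (mmul (wordm p) (mmul (mmul (wordm p') (lm k)) (wordm q'))) (wordm q).
  by rewrite !mulmA.
exact: sQQ'.
Qed.

(** * Buchberger's criterion for a resolvable set *)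

Section Buchberger.
Context (G : set S).
Context (G_neq0 : forall g, G g -> g != 0).
Context (G_resolvable : forall p g q p' g' q', G g -> G g' ->
  let w := mmul (mmul (wordm p) (lm g)) (wordm q) in
  mmul (mmul (wordm p') (lm g')) (wordm q') = w ->
  std G (fun v => lt v w) (kscale (lc g)^-1 (wsandwich p g q) -
                           kscale (lc g')^-1 (wsandwich p' g' q'))).

Lemma std_coefS Q f v : std G Q f -> coefS f v != 0 ->
  exists2 w, Q w & v = w \/ lt v w.
Proof.
elim=> [|h d g p q _ IHh Gg Qg]; first by rewrite coefS0 eqxx.
have [//|] := eqVneq (coefS h v) 0; last by move=> hv _; exact: IHh.
rewrite coefSD => ->; rewrite add0r coefSZ mulf_eq0 negb_or => /andP[_ gv].
exists (lm (wsandwich p g q)); first by rewrite lm_sandwich ?G_neq0.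
have g0 : wsandwich p g q != 0 by rewrite sandwich_neq0 ?G_neq0.
by have [_] := lmP g0; apply.
Qed.

Lemma std_lmlt w f : std G (fun v => lt v w) f -> lmlt w f.
Proof.
move=> sf v fv; case: (std_coefS sf fv) => u uw [->|] // vu.
exact: mo_trans uw.
Qed.

(** A finite nonempty sum has a largest term monomial. It satisfies [Q] itself, so for [Q] of the
    form [lt v w] the new bound is strictly smaller. *)
Lemma std_bound Q f : std G Q f ->
  f = 0 \/ exists2 w, Q w & std G (fun v => v = w \/ lt v w) f.
Proof.
elim=> [|h d g p q _ IHh Gg Qg]; first by left.
set u := mmul _ _ in Qg; right; case: IHh => [->|[w Qw sh]].
  by exists u => //; rewrite add0r; apply: std_term => //; left.
case: (mo_total mo u w) => [lt_u|uE|lt_w].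
- by exists w => //; apply: stdS => //; right.
- by exists w => //; apply: stdS => //; left.
exists u => //; apply: stdS => //; last by left.
apply: std_sub sh => // v [->|lt_v]; right=> //.
exact: mo_trans lt_w.
Qed.

(* Resolvability carries all terms with leading monomial [w] onto one of them. *)
Lemma std_top w f : std G (fun v => v = w \/ lt v w) f ->
  std G (fun v => lt v w) f \/
  exists p g q c, [/\ G g, mmul (mmul (wordm p) (lm g)) (wordm q) = w &
    std G (fun v => lt v w) (f - kscale c (wsandwich p g q))].
Proof.
elim=> [|h d g p q _ IHh Gg [wE|Qg]]; first by left; exact: std0.
  right; case: IHh => [sh|[p' [g' [q' [c [Gg' wE' sh]]]]]].
    by exists p, g, q, d; split; rewrite // addrK.
  (* The term on [g] has leading coefficient [d * lc g]; carrying it by [g'] takes the factor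
     [d * lc g / lc g'], and the error is [d * lc g] times a resolvable difference. *)
  exists p', g', q', (c + d * lc g / lc g'); split=> //.
  have -> : h + kscale d (wsandwich p g q) -
      kscale (c + d * lc g / lc g') (wsandwich p' g' q') =
      (h - kscale c (wsandwich p' g' q')) +
      kscale (d * lc g) (kscale (lc g)^-1 (wsandwich p g q) -
                         kscale (lc g')^-1 (wsandwich p' g' q')).
    rewrite kscaleB !kscaleA mulfK ?lc_neq0 ?G_neq0 // kscaleDl opprD.
    by rewrite !addrA; congr (_ - _); rewrite addrAC.
  by apply/stdD/stdZ => //; rewrite -wE; apply: G_resolvable => //; rewrite wE'.
case: IHh => [sh|[p' [g' [q' [c [Gg' wE' sh]]]]]].
  by left; exact: stdS.
right; exists p', g', q', c; split=> //.
by rewrite addrAC; exact: stdS.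
Qed.

(** Descent on the bound [w] of a representation. After [std_top], either one term with nonzero
    coefficient remains at [w], which is then [lm f], or [f] has a representation with a smaller
    bound. *)
Lemma std_lm_dvd Q f : std G Q f -> f != 0 ->
  exists p g q, G g /\ lm f = mmul (mmul (wordm p) (lm g)) (wordm q).
Proof.
move=> sf f0; have [fE|[w _ {}sf]] := std_bound sf.
  by rewrite fE eqxx in f0.
elim/(well_founded_ind (mo_wf mo)): w => w IHw in f sf f0 *.
have lower : std G (fun v => lt v w) f ->
    exists p g q, G g /\ lm f = mmul (mmul (wordm p) (lm g)) (wordm q).
  move=> /std_bound[fE|[w' lt_w' sf']]; first by rewrite fE eqxx in f0.
  exact: IHw lt_w' _ sf' f0.
have [/lower//|[p [g [q [c [Gg wE sfg]]]]]] := std_top sf.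
(* If the coefficients at [w] cancel, all of [f] is represented below [w] and the induction
   continues. *)
have [c0|c0] := eqVneq c 0.
  by apply: lower; move: sfg; rewrite c0 kscale0l subr0.
exists p, g, q; split=> //; rewrite wE.
have g0 := G_neq0 Gg; have lt_w := std_lmlt sfg.
have fE : f = kscale c (wsandwich p g q) + (f - kscale c (wsandwich p g q)).
  by rewrite addrC subrK.
have irr v : lt v w -> v != w by apply: contraTneq => ->; rewrite (mo_irr mo).
have low0 : coefS (f - kscale c (wsandwich p g q)) w = 0.
  by apply: contraTeq isT => /lt_w/irr; rewrite eqxx.
apply: lm_unique.
  rewrite fE coefSD low0 addr0 coefSZ -wE coefS_sandwichE.
  by rewrite mulf_eq0 negb_or c0 lc_neq0.
move=> v; rewrite fE coefSD.
have [->|/lt_w] := eqVneq (coefS (f - kscale c (wsandwich p g q)) v) 0;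
  last by right.
rewrite addr0 coefSZ mulf_eq0 negb_or => /andP[_ /coefS_sandwich_neq0[u gu ->]].
rewrite -wE; case/lmP: g0 => _ /(_ _ gu)[->|lt_u]; [by left | right].
exact: (mo_compat mo).
Qed.

End Buchberger.

End Leading.

(** * Coincidences of leading words: disjoint factors and S-polynomials *)

Section Overlaps.
Context (K : fieldType) (X : countType) (lt : rel (smon X)).
Context (mo : monomial_ordering lt).
Local Notation S := (Sring K X).
Local Notation s := (@skewvar (Pring K X) (@sigma K X) : Sring K X).
Local Open Scope ring_scope.
Local Notation lm := (lm lt).
Local Notation lc := (lc lt).
Local Notation spoly := (spoly lt).
Local Notation std := (std lt).
Local Notation lmlt := (lmlt lt).
Implicit Types (c : K) (f g h r : S) (l p q z : seq X) (u v w : smon X).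
Implicit Types (d i j : nat) (G : set S) (Q : smon X -> Prop).

(** Constants are central in [S] because [sigma] fixes them. *)
Lemma mulr_kscale f c h : f * kscale c h = kscale c (f * h).
Proof.
apply: skewpolyP => k; rewrite scoefZ !scoefM mulr_sumr; apply: eq_bigr => i _.
by rewrite scoefZ iter_sigmaM iter_sigma_pterm iter_shiftm1 mulrCA.
Qed.

Lemma std_big G Q (r : seq (smon X)) (F : smon X -> S) :
  (forall v, v \in r -> std G Q (F v)) -> std G Q (\sum_(v <- r) F v).
Proof.
move=> sF; rewrite big_seq; apply: big_rec => [|v f /sF]; first exact: std0.
exact: stdD.
Qed.

Lemma std_mull G Q (Q' : smon X -> Prop) h f :
  (forall v, coefS h v != 0 -> exists l, v = wordm l) ->
  (forall v w, coefS h v != 0 -> Q w -> Q' (mmul v w)) ->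
  std G Q f -> std G Q' (h * f).
Proof.
move=> wh sQQ' sf; rewrite [h]coefS_expand mulr_suml; apply: std_big => v _.
have [->|hv] := eqVneq (coefS h v) 0; first by
  rewrite kscale0l mul0r; exact: std0.
rewrite kscaleMl; apply: stdZ; have [l vE] := wh v hv.
have -> : monS K v * f = wsandwich l f [::].
  by rewrite /wsandwich /sandwich vE monS1 mulr1.
by apply: std_wsandwich sf => w Qw; rewrite mulm1 -vE; exact: sQQ'.
Qed.

Lemma std_mulr G Q (Q' : smon X -> Prop) h f :
  (forall v, coefS h v != 0 -> exists l, v = wordm l) ->
  (forall v w, coefS h v != 0 -> Q w -> Q' (mmul w v)) ->
  std G Q f -> std G Q' (f * h).
Proof.
move=> wh sQQ' sf; rewrite [h]coefS_expand mulr_sumr; apply: std_big => v _.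
have [->|hv] := eqVneq (coefS h v) 0; first by
  rewrite kscale0l mulr0; exact: std0.
rewrite mulr_kscale; apply: stdZ; have [l vE] := wh v hv.
have -> : f * monS K v = wsandwich [::] f l.
  by rewrite /wsandwich /sandwich vE monS1 mul1r.
by apply: std_wsandwich sf => w Qw; rewrite mul1m -vE; exact: sQQ'.
Qed.

Lemma lm_monS w : lm (monS K w) = w.
Proof.
apply: (lm_unique mo) => [|v]; first by rewrite coefS_monS eqxx oner_eq0.
by rewrite coefS_monS; case: (w =P v) => [->|]; [left | rewrite eqxx].
Qed.

Lemma lc_monS w : lc (monS K w) = 1.
Proof. by rewrite /lc lm_monS coefS_monS eqxx. Qed.

Lemma monS_neq0 w : monS K w != 0.
Proof.
apply: contra_neq (oner_neq0 K) => e.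
by rewrite -(lc_monS w) e /lc coefS0.
Qed.

Lemma lmlt_tail g : g != 0 -> lmlt (lm g) (kscale (lc g)^-1 g - monS K (lm g)).
Proof.
move=> g0; have := lmlt_cancel mo g0 (monS_neq0 (lm g)).
by rewrite lm_monS lc_monS invr1 kscale1; apply.
Qed.

(* The product criterion: [g m l' - l m g'] is rewritten through
   [(g - l) m g'] and [g m (g' - l')]. *)
Lemma disjoint_std G g g' l l' p m q : G g -> G g' -> g != 0 -> g' != 0 ->
  Rhom (size l) g -> Rhom (size l') g' -> lm g = wordm l -> lm g' = wordm l' ->
  std G (fun v => lt v (wordm (p ++ l ++ m ++ l' ++ q)))
    (kscale (lc g)^-1 (wsandwich p g (m ++ l' ++ q)) -
     kscale (lc g')^-1 (wsandwich (p ++ l ++ m) g' q)).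
Proof.
move=> Gg Gg' g0 g0' Rg Rg' lmg lmg'.
pose Y := kscale (lc g)^-1 g; pose Y' := kscale (lc g')^-1 g'.
pose M := monS K (wordm m).
(* The products [Y * M * Y'] cancel in [D], and each summand has a tail as a factor, which keeps its
   terms strictly below [l ++ m ++ l']. *)
pose D := (Y - monS K (lm g)) * (M * Y') - Y * M * (Y' - monS K (lm g')).
have -> : kscale (lc g)^-1 (wsandwich p g (m ++ l' ++ q)) -
    kscale (lc g')^-1 (wsandwich (p ++ l ++ m) g' q) = wsandwich p D q.
  have -> : D = Y * M * monS K (lm g') - monS K (lm g) * M * Y'.
    rewrite /D mulrBl mulrBr !mulrA opprB addrC addrA; congr (_ - _).
    by rewrite addrAC addrK.
  rewrite /wsandwich sandwichB -!sandwichZ -/Y -/Y' /sandwich !wordm_cat !monSM.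
  by rewrite lmg lmg' !mulrA.
apply: (@std_wsandwich _ _ _ _ (fun v => lt v (wordm (l ++ m ++ l')))).
  move=> v /(mo_compat mo (wordm p) (wordm q)).
  by rewrite !wordm_cat !mulmA.
have words h n (w : seq X) : Rhom n h -> size w = n ->
    forall c v, coefS (kscale c h - monS K (wordm w)) v != 0 ->
    exists t, v = wordm t.
  move=> Rh szw c v; rewrite coefSB coefSZ coefS_monS.
  case: (wordm w =P v) => [<- _|_]; first by exists w.
  by rewrite subr0 mulf_eq0 negb_or => /andP[_ /Rh[t _ ->]]; exists t.
have stdY f : G f -> forall c, std G (fun v => v = lm f) (kscale c f).
  by move=> Gf c; apply/stdZ/std_mem.
apply: stdB.
  apply: (@std_mull _ (fun v => v = mmul (wordm m) (wordm l'))).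
  - by rewrite lmg; exact: (words _ _ _ Rg erefl).
  - move=> v _ hv ->.
    have := mo_compat mo mone (wordm (m ++ l')) (lmlt_tail g0 hv).
    by rewrite lmg !mul1m !wordm_cat.
  apply: (@std_mull _ (fun v => v = wordm l')).
  - by move=> v; rewrite coefS_monS; case: (wordm m =P v) => [<-|];
      [exists m | rewrite eqxx].
  - move=> v u; rewrite coefS_monS; case: (wordm m =P v) => [<- _ ->//|_].
    by rewrite eqxx.
  by rewrite -lmg'; exact: stdY.
apply: (@std_mulr _ (fun v => v = mmul (wordm l) (wordm m))).
- by rewrite lmg'; exact: (words _ _ _ Rg' erefl).
- move=> v _ hv ->; have := mo_compat mo (wordm (l ++ m)) mone (lmlt_tail g0' hv).
  by rewrite lmg' !mulm1 !wordm_cat !mulmA.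
apply: (@std_mulr _ (fun v => v = wordm l)).
- by move=> v; rewrite coefS_monS; case: (wordm m =P v) => [<-|];
    [exists m | rewrite eqxx].
- move=> v u; rewrite coefS_monS; case: (wordm m =P v) => [<- _ ->//|_].
  by rewrite eqxx.
by rewrite -lmg; exact: stdY.
Qed.

Definition shift i g j : S := s ^+ i * g * s ^+ j.

Lemma shiftE i g j :
  shift i g j = sandwich ((1%M, i) : smon X) g ((1%M, j) : smon X).
Proof. by rewrite /shift !skewvarXE. Qed.

Lemma shift0 g : shift 0 g 0 = g.
Proof. by rewrite /shift !expr0 mul1r mulr1. Qed.

Lemma lm_shift i g j l : g != 0 -> lm g = wordm l ->
  lm (shift i g j) = shiftword i l j.
Proof. by move=> g0 lmg; rewrite shiftE (lm_sandwich mo) // lmg. Qed.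

Lemma lc_shift i g j : g != 0 -> lc (shift i g j) = lc g.
Proof. by move=> g0; rewrite shiftE (lc_sandwich mo). Qed.

(** The words of [g] all have the length of [l], so the context that [shiftword_factor] finds for
    [l] serves each of them. *)
Lemma pterm_shift c a i g j l z : Rhom (size l) g ->
  mmul ((a, 0%N) : smon X) (shiftword i l j) = wordm z ->
  exists p q, [/\ z = p ++ l ++ q, size p = i, size q = j &
    pterm c a *: shift i g j = kscale c (wsandwich p g q)].
Proof.
move=> Rg /shiftword_factor[p [q [zE szp szq Ew]]]; exists p, q; split=> //.
rewrite ptermZ shiftE -[_ * _]mulr1 -monS1 -/(sandwich _ _ _) sandwichA.
congr kscale; apply: eq_sandwich => v /Rg[w szw ->].
by have := Ew w szw; rewrite /shiftword !wordm_cat mulm1 !mulmA.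
Qed.

(** Applies [pterm_shift] to both cofactors: an S-polynomial in [R] becomes the difference of two
    word multiples with the common leading word [z]. *)
Lemma spoly_shift i g j i' g' j' l l' z : g != 0 -> g' != 0 ->
  Rhom (size l) g -> Rhom (size l') g' -> lm g = wordm l -> lm g' = wordm l' ->
  size z = (i + size l + j)%N -> size z = (i' + size l' + j')%N ->
  lcm_lm lt (shift i g j) (shift i' g' j') = (wordm z).1 ->
  exists p q p' q', [/\ z = p ++ l ++ q /\ z = p' ++ l' ++ q',
    size p = i /\ size q = j, size p' = i' /\ size q' = j' &
    spoly (shift i g j) (shift i' g' j') =
      kscale (lc g)^-1 (wsandwich p g q) -
      kscale (lc g')^-1 (wsandwich p' g' q')].
Proof.
move=> g0 g0' Rg Rg' lmg lmg' sz sz'; rewrite /lcm_lm.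
rewrite (lm_shift _ _ g0 lmg) (lm_shift _ _ g0' lmg') => lcmz.
have [p [q [zE szp szq E]]] :=
  pterm_shift (lc g)^-1 Rg (divcm_lcm_shiftword lcmz sz).
rewrite lcmcmC in lcmz.
have [p' [q' [zE' szp' szq' E']]] :=
  pterm_shift (lc g')^-1 Rg' (divcm_lcm_shiftword lcmz sz').
exists p, q, p', q'; split=> //.
rewrite /spoly /lcm_lm (lm_shift _ _ g0 lmg) (lm_shift _ _ g0' lmg') !lc_shift //.
by rewrite E -E' lcmcmC.
Qed.

Lemma spoly_in_RP f g : spoly_in_R lt f g <->
  exists z, (lm f).2 = size z /\ lcm_lm lt f g = (wordm z).1.
Proof.
split=> [[d [fd /multideg_word[z zE]]]|[z [fz lE]]].
  by exists z; rewrite -wordm_deg zE.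
by exists (size z); split=> // k; rewrite lE multideg_wordm.
Qed.

(* Unlike reduction to 0, this condition survives the enlargement of [G]. *)
Definition cancels_below G h : Prop :=
  forall w, lmlt w h -> std G (fun v => lt v w) h.

(** The difference is the S-polynomial itself. Its leading terms cancel, so it lies below the common
    word and [cancels_below] applies. *)
Lemma overlap_std G g g' l l' p q p' q' : g != 0 -> g' != 0 ->
  Rhom (size l) g -> Rhom (size l') g' -> lm g = wordm l -> lm g' = wordm l' ->
  p ++ l ++ q = p' ++ l' ++ q' ->
  lcm_lm lt (shift (size p) g (size q)) (shift (size p') g' (size q')) =
    (wordm (p ++ l ++ q)).1 ->
  cancels_below G
    (spoly (shift (size p) g (size q)) (shift (size p') g' (size q'))) ->
  std G (fun v => lt v (wordm (p ++ l ++ q)))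
    (kscale (lc g)^-1 (wsandwich p g q) - kscale (lc g')^-1 (wsandwich p' g' q')).
Proof.
move=> g0 g0' Rg Rg' lmg lmg' zE lcmz.
have sz : size (p ++ l ++ q) = (size p + size l + size q)%N.
  by rewrite !size_cat addnA.
have sz' : size (p ++ l ++ q) = (size p' + size l' + size q')%N.
  by rewrite zE !size_cat addnA.
have [p1 [q1 [p1' [q1' [[zE1 zE1'] [szp szq] [szp' szq'] ->]]]]] :=
  spoly_shift g0 g0' Rg Rg' lmg lmg' sz sz' lcmz.
(* The contexts produced by [spoly_shift] are known only through their sizes, which determine
   them. *)
have cat_inj (a b a' b' t : seq X) : a ++ t ++ b = a' ++ t ++ b' ->
    size a' = size a ->
    a' = a /\ b' = b.
  move=> /eqP; rewrite eq_sym => E sza; move: E.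
  rewrite eqseq_cat // => /andP[/eqP <-].
  by rewrite eqseq_cat // => /andP[_ /eqP <-].
have [-> ->] := cat_inj _ _ _ _ _ zE1 szp.
have [-> ->] := cat_inj _ _ _ _ _ (etrans (esym zE) zE1') szp'.
apply; have lmE a t b h : h != 0 -> lm h = wordm t ->
    lm (wsandwich a h b) = wordm (a ++ t ++ b).
  by move=> h0 lmh; rewrite (lm_sandwich mo) // lmh !wordm_cat !mulmA.
rewrite -(lmE _ _ _ _ g0 lmg) -(lc_sandwich mo (wordm p) (wordm q) g0).
rewrite -(lc_sandwich mo (wordm p') (wordm q') g0').
apply: (lmlt_cancel mo); rewrite ?(sandwich_neq0 mo) //.
by rewrite !(lmE _ _ _ _ _ lmg) // !(lmE _ _ _ _ _ lmg') // zE.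
Qed.

End Overlaps.

Lemma cat_eq_prefix (T : eqType) (a b c d : seq T) :
  a ++ b = c ++ d -> (size a <= size c)%N ->
  exists2 e, c = a ++ e & b = e ++ d.
Proof.
move=> E le_ac; have cE : c = a ++ drop (size a) c.
  rewrite -[LHS](cat_take_drop (size a)); congr (_ ++ _).
  by have := congr1 (take (size a)) E; rewrite take_size_cat // takel_cat.
exists (drop (size a) c) => //; move/eqP: E.
by rewrite {1}cE -catA eqseq_cat // eqxx => /eqP.
Qed.

(** * Pairs of elements and the S-polynomials attached to them *)

Section Algorithm.
Context (K : fieldType) (X : countType) (lt : rel (smon X)).
Context (mo : monomial_ordering lt).
Local Notation S := (Sring K X).
Local Open Scope ring_scope.
Local Notation lm := (lm lt).
Local Notation lc := (lc lt).
Local Notation spoly := (spoly lt).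
Local Notation std := (std lt).
Local Notation lmlt := (lmlt lt).
Local Notation cancels_below := (cancels_below lt).
Implicit Types (c : K) (f g h r : S) (l p q z : seq X) (u v w : smon X).
Implicit Types (d i j : nat) (G : set S) (Q : smon X -> Prop).

Lemma cancels_below_sub (G G' : set S) f :
  (G `<=` G')%classic -> cancels_below G f -> cancels_below G' f.
Proof. by move=> sGG' Gf w /Gf; exact: std_sub. Qed.

Lemma lm_Rhom d f : f != 0 -> Rhom d f ->
  exists2 l, size l = d & lm f = wordm l.
Proof. by move=> /(lmP mo)[flm _] /(_ _ flm). Qed.

Lemma std_context G c c' f f' p q z a b a' b' :
  std G (fun v => lt v (wordm z))
    (kscale c (wsandwich a f b) - kscale c' (wsandwich a' f' b')) ->
  std G (fun v => lt v (wordm (p ++ z ++ q)))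
    (kscale c (wsandwich (p ++ a) f (b ++ q)) -
     kscale c' (wsandwich (p ++ a') f' (b' ++ q))).
Proof.
have E c0 f0 a0 b0 : kscale c0 (wsandwich (p ++ a0) f0 (b0 ++ q)) =
    wsandwich p (kscale c0 (wsandwich a0 f0 b0)) q.
  by rewrite /wsandwich sandwichZ sandwichA -!wordm_cat.
rewrite !E /(wsandwich p) -sandwichB.
apply: (@std_wsandwich _ _ lt G (fun v => lt v (wordm z))) => v.
by move=> /(mo_compat mo (wordm p) (wordm q)); rewrite -!wordm_cat -catA.
Qed.

(** The index set of [loop1]; [overlap] is that of [loop2], written with [shift] on both sides to
    match [overlap_std]. *)
Definition inclusion f g (ij : nat * nat) : Prop :=
  (ij.1 + ij.2 + degs g = degs f)%N /\ spoly_in_R lt f (shift ij.1 g ij.2).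

Definition overlap f g (ij : nat * nat) : Prop :=
  (ij.2 + degs g = degs f + ij.1)%N /\
  spoly_in_R lt (shift 0 f ij.1) (shift ij.2 g 0).

Definition resolved G f g : Prop :=
  (forall ij, inclusion f g ij ->
    cancels_below G (spoly f (shift ij.1 g ij.2))) /\
  (forall ij, overlap f g ij ->
    cancels_below G (spoly (shift 0 f ij.1) (shift ij.2 g 0))).

Lemma resolved_sub (G G' : set S) f g :
  (G `<=` G')%classic -> resolved G f g -> resolved G' f g.
Proof.
move=> sGG' [r1 r2].
by split=> ij; [move/r1 | move/r2]; exact: cancels_below_sub.
Qed.

(** * Resolved pairs make all coincidences of leading words resolvable *)

Section Resolvable.
Context (G : set S).
Context (G_Rhom : forall g, G g -> g != 0 /\ exists d, Rhom d g).
Context (G_resolved : forall f g, G f -> G g -> resolved G f g).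

(** With [p' = p ++ a], the occurrence of [l'] starts at offset [a] from that of [l]. It starts
    after [l] ends, lies inside [l], or overlaps a suffix of [l]. *)
Lemma resolvable_le p g q p' g' q' : G g -> G g' -> (size p <= size p')%N ->
  let w := mmul (mmul (wordm p) (lm g)) (wordm q) in
  mmul (mmul (wordm p') (lm g')) (wordm q') = w ->
  std G (fun v => lt v w) (kscale (lc g)^-1 (wsandwich p g q) -
                           kscale (lc g')^-1 (wsandwich p' g' q')).
Proof.
move=> Gg Gg' le_pp' w; have [g0 [d Rg]] := G_Rhom Gg.
have [g0' [d' Rg']] := G_Rhom Gg'; rewrite {}/w.
have [l szl lmg] := lm_Rhom g0 Rg; have [l' szl' lmg'] := lm_Rhom g0' Rg'.
move: Rg Rg'; rewrite -szl -szl' => Rg Rg' {d d' szl szl'}.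
have dg := degs_Rhom Rg g0; have dg' := degs_Rhom Rg' g0'.
rewrite lmg lmg' -!wordm_cat => /wordm_inj; rewrite -!catA => zE.
have [a p'E {}zE] := cat_eq_prefix (esym zE) le_pp'.
have [le_la|/ltnW le_al] := leqP (size l) (size a).
  (* Disjoint occurrences, separated by [m]. *)
  have [m aE ->] := cat_eq_prefix zE le_la.
  by rewrite p'E aE; apply: (disjoint_std mo).
have [b lE bE] := cat_eq_prefix (esym zE) le_al.
rewrite {le_pp'}p'E; have [le_l'b|/ltnW le_bl'] := leqP (size l') (size b).
  (* Here [l = a ++ l' ++ e]: an S-polynomial of the first loop, multiplied by [p] and [q]. *)
  have [e bE' q'E] := cat_eq_prefix bE le_l'b.
  have zE' : [::] ++ l ++ [::] = a ++ l' ++ e by rewrite cats0 lE bE'.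
  have lcmz := @lcmcm_shiftword _ [::] l [::] a l' e zE' (or_introl erefl)
    (or_introl erefl) (leq0n _).
  have {}lcmz : lcm_lm lt (shift 0 g 0) (shift (size a) g' (size e)) =
      (wordm ([::] ++ l ++ [::])).1.
    rewrite /lcm_lm (lm_shift mo _ _ g0 lmg) (lm_shift mo _ _ g0' lmg').
    by apply: lcmz; rewrite lE bE' !size_cat; lia.
  have := overlap_std (G := G) mo g0 g0' Rg Rg' lmg lmg' zE' lcmz.
  rewrite /= cats0 => std_l.
  rewrite q'E -[p in wsandwich p g]cats0 -[q in wsandwich _ g q]cat0s.
  apply: std_context; apply: std_l; rewrite shift0.
  apply: (G_resolved Gg Gg').1 (size a, size e) _.
  split; first by rewrite /= dg dg' lE bE' !size_cat; lia.
  apply/spoly_in_RP; exists l; rewrite lmg wordm_deg; split=> //.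
  by rewrite -[g]shift0 lcmz cats0.
(* Here [l ++ e = a ++ l']: an S-polynomial of the second loop, multiplied by [p] and [q']. For
   empty [a] the word [l] is a prefix of [l']. *)
have [e l'E qE] := cat_eq_prefix (esym bE) le_bl'.
have zE' : [::] ++ l ++ e = a ++ l' ++ [::] by rewrite cats0 lE l'E -catA.
have lcmz : lcm_lm lt (shift 0 g (size e)) (shift (size a) g' 0) =
    (wordm ([::] ++ l ++ e)).1.
  rewrite /lcm_lm (lm_shift mo _ _ g0 lmg) (lm_shift mo _ _ g0' lmg').
  apply: (@lcmcm_shiftword _ [::] l e a l' [::] zE');
    [by left | by right | by [] |].
  by rewrite lE size_cat; lia.
have := overlap_std (G := G) mo g0 g0' Rg Rg' lmg lmg' zE' lcmz.
rewrite cat0s => std_l.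
rewrite qE -[p in wsandwich p g]cats0 -[q' in wsandwich _ g' q']cat0s.
rewrite [l ++ e ++ q']catA; apply: std_context; apply: std_l.
apply: (G_resolved Gg Gg').2 (size e, size a) _.
split; first by rewrite /= dg dg' lE l'E !size_cat; lia.
apply/spoly_in_RP; exists (l ++ e); split; last exact: lcmz.
by rewrite (lm_shift mo _ _ g0 lmg) !smonM_2 wordm_deg size_cat add0n.
Qed.

(** Exchanging the two terms only changes the sign of the difference. *)
Lemma resolvable p g q p' g' q' : G g -> G g' ->
  let w := mmul (mmul (wordm p) (lm g)) (wordm q) in
  mmul (mmul (wordm p') (lm g')) (wordm q') = w ->
  std G (fun v => lt v w) (kscale (lc g)^-1 (wsandwich p g q) -
                           kscale (lc g')^-1 (wsandwich p' g' q')).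
Proof.
move=> Gg Gg' w wE; have [le_pp'|/ltnW le_p'p] := leqP (size p) (size p').
  exact: resolvable_le.
by rewrite -opprB -kscaleN; apply: stdZ; rewrite -wE; apply: resolvable_le.
Qed.

End Resolvable.

(** * Reduction and the loop invariant *)

Section Invariant.
Context (I H : set S) (idI : ideal I).

(** Kept apart from [basis_elt] because S-polynomials and remainders may be zero. *)
Definition homogeneous_in f : Prop := I f /\ exists d, Rhom d f.

Definition basis_elt f : Prop := f != 0 /\ homogeneous_in f.

(** As [lm h] is a word, [pterm_shift] turns the subtracted multiple into [u g v] with words: the
    step is a division step of the free algebra. *)
Lemma red_step_wsandwich G d h h' : (G `<=` basis_elt)%classic ->
  Rhom d h -> red_step lt (SigmaGSigma G) h h' ->
  exists p g q c, [/\ G g, mmul (mmul (wordm p) (lm g)) (wordm q) = lm h,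
    Rhom d (wsandwich p g q) & h' = h - kscale c (wsandwich p g q)].
Proof.
move=> sG Rh [h0 [_ [a [[g [i [j [Gg ->]]]] _ lmh ->]]]].
have [g0 [_ [d' Rg]]] := sG _ Gg; have [z szz lmz] := lm_Rhom h0 Rh.
have [l szl lmg] := lm_Rhom g0 Rg; rewrite -{}szl in Rg.
rewrite -/(shift i g j) (lm_shift mo _ _ g0 lmg) lmz in lmh *.
have [p [q [zE _ _ ->]]] :=
  pterm_shift (lc h / lc (shift i g j)) Rg (esym lmh).
exists p, g, q, (lc h / lc (shift i g j)); split=> //.
  by rewrite lmg zE !wordm_cat mulmA.
by rewrite -szz zE !size_cat addnA; exact: Rhom_wsandwich.
Qed.

(** Each step subtracts a term with the current leading monomial, hence below any [w] that bounds
    [h]. The subtracted terms add up to the required representation of [h - h']. *)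
Lemma Reduce_std G d h h' : (G `<=` basis_elt)%classic -> I h -> Rhom d h ->
  Reduce lt (SigmaGSigma G) h h' ->
  [/\ I h', Rhom d h' &
    forall w, lmlt w h -> lmlt w h' /\ std G (fun v => lt v w) (h - h')].
Proof.
move=> sG + + red; elim: red => {h h'} [h _|h h1 h2 step _ IH] Ih Rh.
  by split=> // w hw; split=> //; rewrite subrr; exact: std0.
have h0 := step.1.
have [p [g [q [c [Gg lmh Rpq h1E]]]]] := red_step_wsandwich sG Rh step.
have [g0 [Ig _]] := sG _ Gg.
have Ih1 : I h1.
  by rewrite h1E; apply: ideal_sub_closed => //;
    apply: ideal_kscale => //; exact: ideal_wsandwich.
have Rh1 : Rhom d h1 by rewrite h1E; apply/RhomB/RhomZ.
have [Ih2 Rh2 IHw] := IH Ih1 Rh1; split=> // w hw.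
have lt_w := lmlt_lm mo h0 hw.
have h1w : lmlt w h1.
  rewrite h1E; apply: lmltB => //; apply: lmltZ; apply: (lm_lmlt mo).
  by rewrite (lm_sandwich mo) // lmh.
have [h2w sh2] := IHw w h1w; split=> //.
have -> : h - h2 = kscale c (wsandwich p g q) + (h1 - h2).
  by rewrite h1E addrA addrCA subrr addr0.
by apply: stdD => //; apply: std_term; rewrite ?lmh.
Qed.

(** The degree equation gives both multiples the length of the word [z], so [spoly_shift] keeps
    their difference in [I] and in one component. *)
Lemma spoly_shift_homogeneous i f j i' g j' : basis_elt f -> basis_elt g ->
  (i + degs f + j = i' + degs g + j')%N ->
  spoly_in_R lt (shift i f j) (shift i' g j') ->
  homogeneous_in (spoly (shift i f j) (shift i' g j')).
Proof.
move=> [f0 [If [d Rf]]] [g0 [Ig [d' Rg]]] E /spoly_in_RP[z [szz lcmz]].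
have [l szl lmf] := lm_Rhom f0 Rf; have [l' szl' lmg] := lm_Rhom g0 Rg.
rewrite -{}szl in Rf; rewrite -{}szl' in Rg.
rewrite (degs_Rhom Rf f0) (degs_Rhom Rg g0) in E.
rewrite (lm_shift mo _ _ f0 lmf) !smonM_2 wordm_deg /= in szz.
have szz' : size z = (i' + size l' + j')%N by rewrite -szz E.
have [p [q [p' [q' [[zE zE'] _ _ ->]]]]] :=
  spoly_shift mo f0 g0 Rf Rg lmf lmg (esym szz) szz' lcmz.
split; first by apply: ideal_sub_closed => //; apply: ideal_kscale => //;
  exact: ideal_wsandwich.
exists (size z); apply: RhomB; apply: RhomZ.
  by rewrite zE !size_cat addnA; exact: Rhom_wsandwich.
by rewrite zE' !size_cat addnA; exact: Rhom_wsandwich.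
Qed.

(** [current] holds the pair already taken out of [B] whose S-polynomials are still being treated;
    it is empty between passes of the while loop. *)
Definition invariant (current : set (S * S)) (st : state K X) : Prop :=
  [/\ (H `<=` st.1)%classic, (st.1 `<=` basis_elt)%classic,
    (st.2 `<=` st.1 `*` st.1)%classic &
    forall f g, st.1 f -> st.1 g -> ~ current (f, g) ->
      st.2 (f, g) \/ resolved st.1 f g].

Lemma add_elt_sub st h : (st.1 `<=` (add_elt st h).1)%classic.
Proof. by case: st => G B f /=; case: ifP => //; left. Qed.

(** Pairs involving the new element enter [B], and resolved pairs remain resolved in a larger
    set. *)
Lemma add_elt_invariant current st h : homogeneous_in h ->
  invariant current st -> invariant current (add_elt st h).
Proof.
case: st => G B hh [/= sHG sG sB res]; case: eqP => // h0; split=> /=.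
- by move=> f /sHG; left.
- move=> f [/sG//|->]; split=> //; exact/eqP.
- move=> fg [[[/sB[Gf Gg]|->]|[k Gk <-]]|[k Gk <-]]; split=> /=;
    by [left | right].
move=> f g [Gf|->] [Gg|->] nt; last by left; left; left; right.
- case: (res f g Gf Gg nt) => [Bfg|rfg]; first by left; left; left; left.
  by right; apply: resolved_sub rfg => k; left.
- by left; right; exists f.
- by left; left; right; exists g.
Qed.

Lemma for_body_invariant current F s st st' :
  (forall ij, ij \in s -> homogeneous_in (F ij)) ->
  for_body lt F s st st' -> invariant current st ->
  [/\ invariant current st', (st.1 `<=` st'.1)%classic &
    forall ij, ij \in s -> cancels_below st'.1 (F ij)].
Proof.
move=> + body; elim: body => {s st st'} [st|ij s st h st' red _ IH] hF inv.
  by split.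
have [IF [d RF]] := hF ij (mem_head _ _).
have sG : (st.1 `<=` basis_elt)%classic by case: inv.
have [Ih Rh hw] := Reduce_std sG IF RF red.
have hh : homogeneous_in h by split=> //; exists d.
have [inv' sub' cancels'] := IH (fun k sk => hF k (@mem_behead _ (ij :: s) k sk))
  (add_elt_invariant hh inv).
split=> // [f /(add_elt_sub h)/sub'//|ij'].
rewrite inE => /predU1P[->|/cancels'//] w Fw.
have [hw' sFh] := hw w Fw.
(* The reduction represents [F ij - h]; the remainder [h] is zero or, having been added to the set,
   a one-term combination of its own. *)
rewrite -(subrK h (F ij)); apply: stdD.
  by apply: std_sub sFh => // f /(add_elt_sub h)/sub'.
have [->|h0] := eqVneq h 0; first exact: std0.
apply: std_mem; last exact: (lmlt_lm mo).
apply: sub'; case: (st) => G B /=; rewrite (negPf h0); by right.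
Qed.

Lemma while_body_invariant st st' : while_body lt st st' ->
  invariant set0 st -> invariant set0 st'.
Proof.
case: st => G B [f [g [st1 [/= Bfg loop1 loop2]]]] [/= sHG sG sB res].
have [Gf Gg] := sB _ Bfg.
(* The chosen pair is neither in [B] nor resolved while the two loops run, so it is exempted as
   [current]. *)
have inv0 : invariant [set (f, g)] (G, (B `\` [set (f, g)])%classic).
  split=> //= [_ [/sB//]|f' g' Gf' Gg' nt].
  by case: (res f' g' Gf' Gg' id) => [Bfg'|]; [left | right].
case: loop1 => s [_ sE body1].
have hF1 ij : ij \in s ->
    homogeneous_in (spoly f (shift ij.1 g ij.2)).
  move=> /sE[deg]; rewrite -/(shift _ _ _) -[f]shift0 => spR.
  apply: spoly_shift_homogeneous spR; [exact: sG | exact: sG |].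
  by rewrite add0n addn0 -deg addnAC.
have [inv1 sub1 cancels1] := for_body_invariant hF1 body1 inv0.
case: loop2 => t [_ tE body2].
have shiftl i k : shift 0 k i = k * (skewvar (@sigma K X) : S) ^+ i.
  by rewrite /shift expr0 mul1r.
have shiftr i k : shift i k 0 = (skewvar (@sigma K X) : S) ^+ i * k.
  by rewrite /shift expr0 mulr1.
have hF2 ij : ij \in t ->
    homogeneous_in (spoly (f * (skewvar (@sigma K X) : S) ^+ ij.1)
                          ((skewvar (@sigma K X) : S) ^+ ij.2 * g)).
  move=> /tE[deg]; rewrite -shiftl -shiftr => spR.
  apply: spoly_shift_homogeneous spR; [exact: sG | exact: sG |].
  by rewrite add0n addn0 -deg.
have [inv2 sub2 cancels2] := for_body_invariant hF2 body2 inv1.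
case: inv2 => sH2 sG2 sB2 res2; split=> // f' g' Gf' Gg' _.
have [[-> ->]|/eqP nt] := eqVneq (f', g') (f, g); last exact: res2.
(* The loops enumerate all indices of [inclusion] and [overlap]; what the first loop achieved
   survives the additions of the second. *)
right; split=> ij.
  by case=> deg spR; apply: (cancels_below_sub sub2); apply: cancels1; apply/sE.
by case=> deg spR; rewrite shiftl shiftr; apply: cancels2; apply/tE;
  split=> //; rewrite -shiftl -shiftr.
Qed.

Lemma while_loop_invariant st G : while_loop lt st G ->
  invariant set0 st -> invariant set0 (G, set0).
Proof.
by elim=> {st G} // st st' G step _ IH /(while_body_invariant step).
Qed.

End Invariant.

(** * From generated ideals to combinations of words, and correctness of the output *)

Lemma ideal_gen_sub (A A' : set S) f :
  (forall a, A a -> exists p a' q, A' a' /\ a = wsandwich p a' q) ->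
  ideal_gen A f -> ideal_gen A' f.
Proof.
move=> sAA'; elim=> [|h r a r' _ IHh Rr Aa Rr']; first exact: ideal_gen0.
have [p [a' [q [Aa' ->]]]] := sAA' a Aa.
rewrite /wsandwich /sandwich !mulrA -[_ * _ * r']mulrA.
by apply: ideal_genD => //; apply: inR_mul => //; exact: inR_wordm.
Qed.

(** Expanding both outer factors of [r a r'] into words gives terms [c u a v]; no bound on them is
    asked for. *)
Lemma ideal_gen_std (H G : set S) f : (H `<=` G)%classic -> ideal_gen H f ->
  std G (fun=> True) f.
Proof.
move=> sHG; elim=> [|h r a r' _ IHh Rr Ha Rr']; first exact: std0.
apply: stdD => //; apply: (@std_mulr _ _ _ _ (fun=> True)) => //.
  by move=> v; exact: inR_coefS.
apply: (@std_mull _ _ _ _ (fun=> True)) => //.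
  by move=> v; exact: inR_coefS.
by apply: std_mem => //; exact: sHG.
Qed.

End Algorithm.

Theorem proposition6p7 (K : fieldType) (X : countType) (lt : rel (smon X))
    (I H G : set (Sring K X)) :
  monomial_ordering lt ->
  ideal I -> graded I ->
  homogeneous_basis I H ->
  FreeGBasis2 lt H G ->
  groebner_basis lt I G /\ (forall g, G g -> homogeneous g).
Proof.
move=> mo idI _ [sHI H_hom HI] algo.
(* Initially [B] contains every pair, so the condition on pairs holds without any of them being
   resolved. *)
have [|sHG sG _ res] := while_loop_invariant (I := I) (H := H) mo idI algo.
  split=> //= [h Hh|f g Hf Hg _]; last by left.
  have [h0 hom] := H_hom h Hh; have Ih := sHI h Hh.
  by do 2!split=> //; apply: inR_homogeneous_Rhom => //; exact: (ideal_sub idI).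
have G_Rhom g : G g -> (g != 0)%R /\ exists d, Rhom d g.
  by move=> /sG[g0 [_ Rg]].
have sGI : (G `<=` I)%classic by move=> g /sG[_ []].
split; last by move=> g /G_Rhom[_ [d Rg]]; exact: Rhom_homogeneous Rg.
split=> //; apply/seteqP; split=> f.
  apply: ideal_gen_sub => _ [g [Gg g0] <-].
  exists [::], (monS K (lm lt g)), [::]; rewrite /wsandwich sandwich1.
  by split=> //; exists g => //; split=> //; exact: sGI.
(* The substantial inclusion: each [lm] of an element of [I] must be a word multiple of some [lm] of
   an element of [G]. *)
apply: ideal_gen_sub => _ [g [Ig g0] <-].
have sg : std lt G (fun=> True) g.
  by apply: (ideal_gen_std lt sHG); rewrite HI.
(* At termination [B] is empty, which leaves only the alternative that the pair is resolved. *)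
have G_resolved f' g' : G f' -> G g' -> resolved lt G f' g'.
  by move=> Gf Gg; case: (res f' g' Gf Gg id).
have [p [h [q [Gh ->]]]] :=
  std_lm_dvd mo (fun k Gk => (G_Rhom k Gk).1)
    (resolvable mo G_Rhom G_resolved) sg g0.
exists p, (monS K (lm lt h)), q; split; last first.
  by rewrite /wsandwich /sandwich !monSM.
by exists h => //; split=> //; exact: (G_Rhom h Gh).1.
Qed.
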